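(* Let $K$ be a simple Legendrian front split by a vertical dividing line, meeting it in $n$ points, into a left half $K^A$ and a right half $K^D$; or, let $K_1,K_2,K_3$ be adjacent regions (from left to right, separated by vertical dividing lines) of a simple front with $K_{12}=K_1\cup K_2$, $K_{23}=K_2\cup K_3$, and $K_{123}=K_1\cup K_2\cup K_3$. Then the diagrams $$\begin{array}{ccc} \mathcal{C}(I_n) & \longrightarrow & \mathcal{C}(D(K^D))\\ {\scriptstyle \mathcal{C}(w)}\downarrow & & \downarrow{\scriptstyle \mathcal{C}(w')}\\ \mathcal{C}(A(K^A)) & \longrightarrow & \mathcal{C}(Ch(K))\end{array}\qquad\begin{array}{ccc} \mathcal{C}(DA(K_2)) & \longrightarrow & \mathcal{C}(DA(K_{23}))\\ {\scriptstyle \mathcal{C}(w)}\downarrow & & \downarrow{\scriptstyle \mathcal{C}(w')}\\ \mathcal{C}(DA(K_{12})) & \longrightarrow & \mathcal{C}(DA(K_{123}))\end{array}$$ (respectively), whose unlabeled arrows are induced by inclusions, are pushout squares in the category of graded algebras.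
   Context: **DGAs and characteristic algebras.** $\mathbb{F}=\mathbb{Z}/2\mathbb{Z}$ and $\Gamma$ is a fixed cyclic group; graded algebras are associative unital $\Gamma$-graded $\mathbb{F}$-algebras. A DGA is such an algebra with a differential $\partial$ of degree $-1$ satisfying the Leibniz rule and $\partial^2=0$. A DGA morphism is a unital algebra homomorphism preserving gradings and commuting with $\partial$. For a DGA $A$, the characteristic algebra is $\mathcal{C}(A)=A/I$, where $I$ is the two-sided ideal generated by the image of $\partial$, with the inherited grading; a DGA morphism $f:X\to Y$ descends to a morphism $\mathcal{C}(f):\mathcal{C}(X)\to\mathcal{C}(Y)$. **Fronts.** A front is the (generic) projection to the $xz$-plane of a Legendrian link in $(\mathbb{R}^3,\ker(dz-y\,dx))$; it has no vertical tangents and its singularities are transverse crossings and left/right cusps. At a crossing the strand of smaller slope passes over and is called the top strand; the other is the bottom strand. A front is simple if a planar isotopy makes all of its right cusps have the same $x$-coordinate; a piece of a front cut out by vertical lines is simple if no right cusp lies in a compact region bounded by the front and the vertical lines. The vertices are the crossings and right cusps. A Maslov potential $\mu$ assigns an element of $\Gamma$ to each strand so that at every cusp the upper strand has potential one greater than the lower strand; all fronts carry a chosen Maslov potential. Points on a dividing line are numbered from top to bottom, and $\mu(i)$ is the potential of the strand through the $i$th point. **Disks.** Let $L$ be a simple piece of a front between a left dividing line, met in points $x_1,\dots,x_n$, and a right dividing line, met in points $x'_1,\dots,x'_m$ (either line may be absent, and then $n=0$, respectively $m=0$). For a vertex $v$ of $L$, $\mathrm{Disk}(L;v)$ is the set of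 disks $D\subset\mathbb{R}^2$ with $\partial D\subset L$ such that (1) $D$ is smoothly embedded except possibly at vertices and left cusps; (2) $v$ is the unique rightmost point of $D$; (3) $D$ has a unique leftmost point, at a left cusp of $L$; (4) at each corner, i.e. each crossing $c\neq v$ where $D$ is singular, $D$ occupies near $c$ exactly one of the four regions cut out by $L$. $\mathrm{Half}_D(L;v)$ is defined in the same way except that (3) is replaced by: the leftmost part of the boundary is a segment of the left dividing line between some $x_k$ and $x_l$, $k<l$. $\mathrm{Half}_{DA}(L;i,j)$, $1\le i<j\le m$, is defined in the same way except that (2) is replaced by: the rightmost part of the boundary is the segment of the right dividing line from $x'_i$ to $x'_j$; and the left end may be either a left cusp or a segment of the left dividing line. In each case $\partial D$ (or $\partial H$) is the product of the corners in counterclockwise order, starting from $v$ (respectively from $x'_i$ and ending at $x'_j$), with $\rho_{kl}$ inserted where the boundary runs along the segment from $x_k$ to $x_l$ of the left dividing line. **Algebras.** $I_n$ is the DGA freely generated by $\rho_{ij}$, $1\le i<j\le n$, with $|\rho_{ij}|=\mu(i)-\mu(j)-1$ and $\partial\rho_{ij}=\sum_{i<k<j}\rho_{ik}\rho_{kj}$. $DA(L)$ is the DGA freely generated by the vertices of $L$ and the generators $\rho_{ij}$ of the algebra $I_n$ of the left dividing line. Right cusps have grading $1$, a crossing with top strand $s_1$ and bottom strand $s_2$ has grading $\mu(s_1)-\mu(s_2)$, $\partial\rho_{ij}$ is as in $I_n$, and $\partial v=\epsilon_v+\sum_{D\in\mathrm{Disk}(L;v)}\partial D+\sum_{H\in\mathrm{Half}_D(L;v)}\partial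 H$, where $\epsilon_v=1$ if $v$ is a right cusp and $0$ if $v$ is a crossing. Writing $I'_m$ for the algebra of the right dividing line with generators $\rho'_{ij}$, there is a DGA morphism $w:I'_m\to DA(L)$, $w(\rho'_{ij})=\sum_{H\in\mathrm{Half}_{DA}(L;i,j)}\partial H$. One writes $A(K^A)=DA(K^A)$ when there is no left line, $D(K^D)=DA(K^D)$ when there is no right line, and $Ch(K)=DA(K)$ when there is neither. **Maps.** In the first diagram $w:I_n\to A(K^A)$ is the morphism just defined for $L=K^A$, and $w':D(K^D)\to Ch(K)$ is the identity on vertices and sends $\rho_{ij}$ to $w(\rho_{ij})\in A(K^A)\subset Ch(K)$. In the second diagram $w$ and $w'$ fix the vertices of $K_2$ and $K_{23}$ respectively and send each generator $\rho_{ij}$ of the line between $K_1$ and $K_2$ to $w(\rho_{ij})\in DA(K_1)$, regarded in $DA(K_{12})$ and $DA(K_{123})$ respectively. *)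

(* Defs.v *)
From HB Require Import structures.
From mathcomp Require Import all_boot all_order all_algebra.
From mathcomp Require Import boolp finmap.
From mathcomp.multinomials Require Import monalg.

Set Implicit Arguments.
Unset Strict Implicit.
Unset Printing Implicit Defensive.

Import GRing.Theory.

(* A generic front is recorded, up to planar isotopies that do not change the
   order of the x-coordinates of its singularities, by the list of these
   singularities from left to right.  Strands are numbered from top to bottom
   starting from 0.
   [LCusp k]: a left cusp whose two strands are the strands k, k.+1 on its right;
   [Cross k]: the strands k and k.+1 cross;
   [RCusp k]: the strands k, k.+1 on its left end in a right cusp. *)
Inductive event := LCusp of nat | Cross of nat | RCusp of nat.

Definition pos e := match e with LCusp k | Cross k | RCusp k => k end.
Definition nin e := match e with LCusp _ => 0 | _ => 2 end.
Definition nout e := match e with RCusp _ => 0 | _ => 2 end.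

Definition is_cross e := if e is Cross _ then true else false.
Definition is_lcusp e := if e is LCusp _ then true else false.
Definition is_rcusp e := if e is RCusp _ then true else false.

Definition ev (F : seq event) t := nth (LCusp 0) F t.

(* The number of strands over slice t, a vertical line between the singularities
   number t.-1 and t; slice 0 is left of the front, slice [size F] right of it. *)
Definition width (F : seq event) t :=
  foldl (fun n e => n - nin e + nout e) 0 (take t F).

Definition is_front (F : seq event) :=
  (forall t, t < size F -> pos (ev F t) + nin (ev F t) <= width F t) /\
  width F (size F) = 0.

(* The position on the right of a singularity of the strand that is i-th on its
   left, if the strand continues. *)
Definition next e i : option nat :=
  match e with
  | LCusp k => Some (if i < k then i else i.+2)
  | Cross k => Some (if i == k then k.+1 else if i == k.+1 then k else i)
  | RCusp k => if i < k then Some i else if i < k.+2 then None else Some i.-2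
  end.

(* A planar isotopy through fronts exchanges the x-coordinates of consecutive
   singularities e1, e2, with e2 entirely below e1 (or, inversely, above). *)
Definition move e p :=
  match e with LCusp _ => LCusp p | Cross _ => Cross p | RCusp _ => RCusp p end.

Inductive isotopic : seq event -> seq event -> Prop :=
| iso_refl F : isotopic F F
| iso_sym F G : isotopic F G -> isotopic G F
| iso_trans F G H : isotopic F G -> isotopic G H -> isotopic F H
| iso_swap F1 F2 e1 e2 : pos e1 + nout e1 <= pos e2 ->
    isotopic (F1 ++ [:: e1, e2 & F2])
             (F1 ++ [:: move e2 (pos e2 - nout e1 + nin e1), e1 & F2]).

(* All right cusps have the same x-coordinate: as every local maximum of x is a
   right cusp, this coordinate is the maximum of x, and the cusps, listed from
   top to bottom, join the strands 0, 1, then 2, 3, and so on. *)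
Definition simple_front F :=
  exists (G : seq event) (m : nat),
    isotopic F (G ++ nseq m (RCusp 0)) /\ ~~ has is_rcusp G.

(* The piece [(a, b)] of F, a <= b, is its part between the slices a
    and b.  A dividing line at a slice of width 0 is the same as no line. *)

(* Over slice t, gap g (0 <= g <= width F t) is the interval just above strand g,
   i.e. between the strands g.-1 and g; gaps 0 and [width F t] are unbounded.
   [same_face e g h]: near the singularity e, gap g on its left and gap h on its
   right belong to the same region.  The four regions at a crossing are
   thus k (top), k.+1 on the left, k.+1 on the right, and k.+2 (bottom). *)
Definition same_face e g h :=
  match e with
  | LCusp k => (g <= k) && (h == g) || (k <= g) && (h == g.+2)
  | Cross k => (g != k.+1) && (h == g)
  | RCusp k => (h <= k) && (g == h) || (k <= h) && (g == h.+2)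
  end.

(* The gaps lying in the unbounded components of the complement of the piece in
   the plane strip between its dividing lines. *)
Inductive unbounded (F : seq event) (a b : nat) : nat -> nat -> Prop :=
| unbounded_top t : a <= t <= b -> unbounded F a b t 0
| unbounded_bot t : a <= t <= b -> unbounded F a b t (width F t)
| unbounded_right t g h : a <= t < b -> g <= width F t ->
    same_face (ev F t) g h ->
    unbounded F a b t g -> unbounded F a b t.+1 h
| unbounded_left t g h : a <= t < b -> g <= width F t ->
    same_face (ev F t) g h ->
    unbounded F a b t.+1 h -> unbounded F a b t g.

(* A right cusp lies in (the interior of) a compact region bounded by the front
   and the dividing lines iff the components k (outside the cusp) and
   k.+1 (inside the cusp) of the complement adjacent to it are both bounded. *)
Definition simple_piece F a b :=
  forall t k, a <= t < b -> ev F t = RCusp k ->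
    unbounded F a b t k \/ unbounded F a b t k.+1.

Section Disks.
Variable F : seq event.

(* A cell (t, g) stands for the part of gap g near slice t.  A front has
   at most [2 * size F] strands.  A region of the plane whose boundary lies
   on the front and the dividing lines is recorded by the set of its cells. *)
Definition cell := ('I_(size F).+1 * 'I_(size F).*2.+1)%type.

Definition occ (D : {set cell}) (t g : nat) : bool :=
  [exists c in D, (c.1 == t :> nat) && (c.2 == g :> nat)].

Definition top_of D t := occ D t (pos (ev F t)).
Definition bottom_of D t := occ D t (pos (ev F t)).+2.
Definition left_of D t := occ D t (pos (ev F t)).+1.
Definition right_of D t := occ D t.+1 (pos (ev F t)).+1.

(* The singularity number t is a local rightmost (resp. leftmost) point of D. *)
Definition right_end D t :=
  match ev F t with
  | LCusp _ => false
  | Cross _ => [&& left_of D t, ~~ top_of D t, ~~ bottom_of D t & ~~ right_of D t]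
  | RCusp _ => left_of D t && ~~ top_of D t
  end.

Definition left_end D t :=
  match ev F t with
  | LCusp _ => right_of D t && ~~ top_of D t
  | Cross _ => [&& right_of D t, ~~ top_of D t, ~~ bottom_of D t & ~~ left_of D t]
  | RCusp _ => false
  end.

(* At the crossing t, D is not singular: it is empty, or everything, or one side
   of one of the two strands. *)
Definition nonsingular D t :=
  (top_of D t == right_of D t) && (bottom_of D t == left_of D t) ||
  (top_of D t == left_of D t) && (bottom_of D t == right_of D t).

Definition corner D t :=
  (top_of D t + bottom_of D t + left_of D t + right_of D t == 1)%N.

Definition empty_slice (D : {set cell}) t :=
  [forall g : 'I_(size F).*2.+1, ~~ occ D t g].

Definition segment_slice (D : {set cell}) t i j :=
  (i < j) && [forall g : 'I_(size F).*2.+1, occ D t g == (i < g <= j)].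

(* The conditions common to all disks in the piece (a, b).
   - D is a compact part of the strip.
   - D is a disk.  Extremal points being local ones, x has on D a unique
     local minimum and a unique local maximum, and so D is
     an embedded disk exactly when its vertical slices are connected and it is
     not pinched at a crossing (which the last condition forbids).
   - The boundary of D lies on the front.
   - At a crossing other than its right end, D is smooth or has a corner at
     which it occupies one of the four regions. *)
Definition disk_like a b (D : {set cell}) : bool :=
  [&& [forall c in D, (a <= c.1 <= b) && (0 < c.2 < width F c.1)],
      [forall c1 in D, forall c2 in D, forall c : cell,
         [&& c.1 == c1.1, c1.1 == c2.1 & c1.2 <= c.2 <= c2.2] ==> (c \in D)],
      [forall t : 'I_(size F), (a <= t < b) ==>
         [forall g : 'I_(size F).*2.+1, forall h : 'I_(size F).*2.+1,
            same_face (ev F t) g h ==> (occ D t g == occ D t.+1 h)]] &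
      [forall t : 'I_(size F),
         [&& a <= t < b, is_cross (ev F t) & ~~ right_end D t] ==>
         nonsingular D t || corner D t]].

(* The right end of D is the vertex v, resp. the segment of the right dividing
   line between strands i and j. *)
Definition ends_at_vertex a b D v :=
  [&& a <= v < b, empty_slice D b &
      [forall t : 'I_(size F), (a <= t < b) ==> (right_end D t == (t == v :> nat))]].

Definition ends_at_line a b D i j :=
  segment_slice D b i j &&
  [forall t : 'I_(size F), (a <= t < b) ==> ~~ right_end D t].

Definition starts_at_cusp a b D :=
  empty_slice D a &&
  [exists u : 'I_(size F), [&& a <= u < b, is_lcusp (ev F u) &
     [forall t : 'I_(size F), (a <= t < b) ==> (left_end D t == (t == u))]]].

Definition starts_at_line a b D :=
  [exists k : 'I_(width F a), exists l : 'I_(width F a), segment_slice D a k l] &&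
  [forall t : 'I_(size F), (a <= t < b) ==> ~~ left_end D t].

Definition Disk a b v D :=
  [&& disk_like a b D, ends_at_vertex a b D v & starts_at_cusp a b D].

Definition HalfD a b v D :=
  [&& disk_like a b D, ends_at_vertex a b D v & starts_at_line a b D].

Definition HalfDA a b i j D :=
  [&& disk_like a b D, ends_at_line a b D i j &
      starts_at_cusp a b D || starts_at_line a b D].

(* Names of generators: [inl t] is the vertex number t, [inr (i, j)] is rho_ij. *)
Definition gen := (nat + nat * nat)%type.

(* The boundary word, counterclockwise from the right end: along the upper
   boundary from right to left, where D occupies the bottom region at a corner,
   then along the left dividing line, then along the lower boundary from left
   to right, where D occupies the top region at a corner. *)
Definition boundary a b (D : {set cell}) : seq gen :=
  let corners := [seq t <- iota a (b - a) |
                    is_cross (ev F t) && corner D t] in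
  [seq inl t | t <- rev corners & bottom_of D t] ++
  [seq inr p | p <- [seq (k, l) | k <- iota 0 (width F a), l <- iota 0 (width F a)]
             & segment_slice D a p.1 p.2] ++
  [seq inl t | t <- corners & top_of D t].

End Disks.

Local Open Scope ring_scope.
Local Open Scope quotient_scope.

(* Gamma is cyclic with generator gamma, which plays the role of 1 in Z. *)
Definition cyclic_generator (Gamma : zmodType) (gamma : Gamma) :=
  forall x : Gamma, exists z : int, x = gamma *~ z.

(* [mu t i] is the potential of the i-th strand over slice t. *)
Definition is_maslov (Gamma : zmodType) (gamma : Gamma) (F : seq event)
    (mu : nat -> nat -> Gamma) :=
  forall t, (t < size F)%N ->
    (forall i j, (i < width F t)%N -> next (ev F t) i = Some j ->
       mu t.+1 j = mu t i) /\
    match ev F t with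
    | LCusp k => mu t.+1 k = mu t.+1 k.+1 + gamma
    | Cross _ => True
    | RCusp k => mu t k = mu t k.+1 + gamma
    end.

Inductive in_ideal (A : pzRingType) (S : A -> Prop) : A -> Prop :=
| ideal_gen x : S x -> in_ideal S x
| ideal_zero : in_ideal S 0
| ideal_add x y : in_ideal S x -> in_ideal S y -> in_ideal S (x + y)
| ideal_mull a x : in_ideal S x -> in_ideal S (a * x)
| ideal_mulr a x : in_ideal S x -> in_ideal S (x * a).

Section RingQuotient.
Variables (A : pzRingType) (S : A -> Prop).

Definition ideal_equiv (x y : A) : bool := `[< in_ideal S (x - y) >].

Lemma ideal_opp x : in_ideal S x -> in_ideal S (- x).
Proof. by move=> Ix; rewrite -mulN1r; apply: ideal_mull. Qed.

Lemma ideal_equiv_refl : reflexive ideal_equiv.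
Proof. by move=> x; apply/asboolP; rewrite subrr; apply: ideal_zero. Qed.

Lemma ideal_equiv_sym : symmetric ideal_equiv.
Proof.
by move=> x y; apply/asboolP/asboolP => /ideal_opp; rewrite opprB.
Qed.

Lemma ideal_equiv_trans : transitive ideal_equiv.
Proof.
move=> y x z /asboolP xy /asboolP yz; apply/asboolP.
by rewrite -(subrKA y); apply: ideal_add.
Qed.

Canonical ideal_equiv_rel := EquivRel ideal_equiv
  ideal_equiv_refl ideal_equiv_sym ideal_equiv_trans.

Definition quo := {eq_quot ideal_equiv_rel}.

HB.instance Definition _ := Choice.on quo.
HB.instance Definition _ := EqQuotient.on quo.

Definition quo_zero : quo := \pi 0.
Definition quo_one : quo := \pi 1.
Definition quo_opp : quo -> quo := lift_op1 quo -%R.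
Definition quo_add : quo -> quo -> quo := lift_op2 quo +%R.
Definition quo_mul : quo -> quo -> quo := lift_op2 quo *%R.

Lemma quo_eqP x y : reflect (\pi_quo x = \pi_quo y) (ideal_equiv x y).
Proof. exact: (iffP (eqmodP _ _ _)). Qed.

Lemma pi_quo_opp x : \pi_quo (- x) = quo_opp (\pi x).
Proof.
unlock quo_opp; apply/quo_eqP/asboolP; rewrite -opprD; apply: ideal_opp.
by apply/asboolP/quo_eqP; rewrite reprK.
Qed.

Lemma pi_quo_add x y : \pi_quo (x + y) = quo_add (\pi x) (\pi y).
Proof.
unlock quo_add; apply/quo_eqP/asboolP; rewrite opprD addrACA.
by apply: ideal_add; apply/asboolP/quo_eqP; rewrite reprK.
Qed.

Lemma pi_quo_mul x y : \pi_quo (x * y) = quo_mul (\pi x) (\pi y).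
Proof.
unlock quo_mul; apply/quo_eqP/asboolP.
set x' := repr _; set y' := repr _.
rewrite -(subrKA (x' * y)) -mulrBl -mulrBr.
by apply: ideal_add; [apply: ideal_mulr | apply: ideal_mull];
  apply/asboolP/quo_eqP; rewrite reprK.
Qed.

Lemma quo_addA : associative quo_add.
Proof.
elim/quotW=> x; elim/quotW=> y; elim/quotW=> z.
by rewrite -!pi_quo_add addrA.
Qed.

Lemma quo_addC : commutative quo_add.
Proof.
by elim/quotW=> x; elim/quotW=> y; rewrite -!pi_quo_add addrC.
Qed.

Lemma quo_add0 : left_id quo_zero quo_add.
Proof. by elim/quotW=> x; rewrite -pi_quo_add add0r. Qed.

Lemma quo_addN : left_inverse quo_zero quo_opp quo_add.
Proof. by elim/quotW=> x; rewrite -pi_quo_opp -pi_quo_add addNr. Qed.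

HB.instance Definition _ :=
  GRing.isZmodule.Build quo quo_addA quo_addC quo_add0 quo_addN.

Lemma quo_mulA : associative quo_mul.
Proof.
elim/quotW=> x; elim/quotW=> y; elim/quotW=> z.
by rewrite -!pi_quo_mul mulrA.
Qed.

Lemma quo_mul1l : left_id quo_one quo_mul.
Proof. by elim/quotW=> x; rewrite -pi_quo_mul mul1r. Qed.

Lemma quo_mul1r : right_id quo_one quo_mul.
Proof. by elim/quotW=> x; rewrite -pi_quo_mul mulr1. Qed.

Lemma quo_mulDl : left_distributive quo_mul quo_add.
Proof.
elim/quotW=> x; elim/quotW=> y; elim/quotW=> z.
by rewrite -!(pi_quo_mul, pi_quo_add) mulrDl.
Qed.

Lemma quo_mulDr : right_distributive quo_mul quo_add.
Proof.
elim/quotW=> x; elim/quotW=> y; elim/quotW=> z.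
by rewrite -!(pi_quo_mul, pi_quo_add) mulrDr.
Qed.

(* Only a pzRingType: characteristic algebras may vanish. *)
HB.instance Definition _ := GRing.Zmodule_isPzRing.Build quo
  quo_mulA quo_mul1l quo_mul1r quo_mulDl quo_mulDr.

Definition quo_pi (x : A) : quo := \pi x.

End RingQuotient.

(* An F_2-algebra is a ring in which 1 + 1 = 0, and ring morphisms between such
   rings are F_2-linear.  [pregraded] is a ring with a family of subsets,
   [is_graded_algebra] says that it is a graded algebra. *)
Record pregraded (Gamma : zmodType) := Pregraded {
  gr_ring :> pzRingType;
  gr_comp : Gamma -> gr_ring -> Prop }.

Record is_graded_algebra (Gamma : zmodType) (A : pregraded Gamma) : Prop := {
  gr_char2 : 1 + 1 = 0 :> A;
  gr_zero : forall g, gr_comp g (0 : A);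
  gr_add : forall g (x y : A), gr_comp g x -> gr_comp g y -> gr_comp g (x + y);
  gr_one : gr_comp 0 (1 : A);
  gr_mul : forall g h (x y : A),
    gr_comp g x -> gr_comp h y -> gr_comp (g + h) (x * y);
  gr_span : forall x : A, exists (s : seq Gamma) (f : Gamma -> A),
    (forall g, gr_comp g (f g)) /\ x = \sum_(g <- s) f g;
  gr_direct : forall (s : seq Gamma) (f : Gamma -> A), uniq s ->
    (forall g, gr_comp g (f g)) -> \sum_(g <- s) f g = 0 ->
    forall g, g \in s -> f g = 0 }.

Definition is_graded_morphism (Gamma : zmodType) (A B : pregraded Gamma)
    (f : A -> B) :=
  forall g x, gr_comp g x -> gr_comp g (f x).

(* The commutative square   A --f--> B
                          g |        | g'
                            v        v
                            C --f'-> P   is a pushout of graded algebras. *)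
Definition is_pushout (Gamma : zmodType) (A B C P : pregraded Gamma)
    (f : {rmorphism A -> B}) (g : {rmorphism A -> C})
    (g' : {rmorphism B -> P}) (f' : {rmorphism C -> P}) : Prop :=
  [/\ [/\ is_graded_algebra A, is_graded_algebra B, is_graded_algebra C
        & is_graded_algebra P],
      [/\ is_graded_morphism f, is_graded_morphism g, is_graded_morphism g'
        & is_graded_morphism f'],
      forall x, g' (f x) = f' (g x) &
      forall (Q : pregraded Gamma)
             (p : {rmorphism B -> Q}) (q : {rmorphism C -> Q}),
        is_graded_algebra Q -> is_graded_morphism p -> is_graded_morphism q ->
        (forall x, p (f x) = q (g x)) ->
        exists h : {rmorphism P -> Q},
          [/\ is_graded_morphism h, forall x, h (g' x) = p x,
              forall x, h (f' x) = q x &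
              forall h' : {rmorphism P -> Q}, is_graded_morphism h' ->
                (forall x, h' (g' x) = p x) -> (forall x, h' (f' x) = q x) ->
                forall x, h' x = h x]].

Record predga (Gamma : zmodType) := Predga {
  dga_alg :> pregraded Gamma;
  diff : dga_alg -> dga_alg }.

Section CharacteristicAlgebra.
Variables (Gamma : zmodType) (A : predga Gamma).

Definition im_diff (y : A) := exists x, y = diff x.

Definition char_alg : pregraded Gamma :=
  Pregraded (fun g (y : quo im_diff) => exists2 x : A, gr_comp g x & y = quo_pi _ x).

Definition char_proj (x : A) : char_alg := quo_pi im_diff x.

End CharacteristicAlgebra.

(* The map on characteristic algebras induced by f; it is unique, the
   projections being surjective. *)
Definition induced (Gamma : zmodType) (A B : predga Gamma) (f : A -> B)
    (cf : char_alg A -> char_alg B) :=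
  forall x, cf (char_proj x) = char_proj (f x).

Definition char_pushout (Gamma : zmodType) (A B C P : predga Gamma)
    (f : A -> B) (g : A -> C) (g' : B -> P) (f' : C -> P) : Prop :=
  exists (cf : {rmorphism char_alg A -> char_alg B})
         (cg : {rmorphism char_alg A -> char_alg C})
         (cg' : {rmorphism char_alg B -> char_alg P})
         (cf' : {rmorphism char_alg C -> char_alg P}),
    [/\ induced f cf, induced g cg, induced g' cg' & induced f' cf'] /\
    is_pushout cf cg cg' cf'.

Section FreeAlgebra.
Variable X : choiceType.

Definition free := {malg 'F_2[{fmonom X}]}.

HB.instance Definition _ := GRing.Lalgebra.on free.

Definition fgen (x : X) : free := << fmu x >>.

Definition fext (B : lalgType 'F_2) (f : X -> B) (p : free) : B :=
  \sum_(m <- msupp p) p@_m *: \prod_(x <- (m : seq X)) f x.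

Fixpoint leibniz (d : X -> free) (s : seq X) : free :=
  if s is x :: s' then d x * (\prod_(y <- s') fgen y) + fgen x * leibniz d s'
  else 0.

Definition fder (d : X -> free) (p : free) : free :=
  \sum_(m <- msupp p) p@_m *: leibniz d (m : seq X).

Definition fcomp (Gamma : zmodType) (deg : X -> Gamma) (g : Gamma) (p : free) :=
  forall m, m \in msupp p -> \sum_(x <- (m : seq X)) deg x = g.

End FreeAlgebra.

Section Pieces.
Variables (Gamma : zmodType) (gamma : Gamma).
Variables (F : seq event) (mu : nat -> nat -> Gamma).

Definition is_gen (a b : nat) (x : gen) : bool :=
  match x with
  | inl t => (a <= t < b)%N && ~~ is_lcusp (ev F t)
  | inr (i, j) => (i < j < width F a)%N
  end.

Definition gens a b := {x : gen | is_gen a b x}.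

Definition DA_alg a b := free (gens a b).

(* The generator with a given name; used only for actual generators. *)
Definition named a b (x : gen) : DA_alg a b :=
  if insub x is Some y then fgen y else 0.

Definition word a b (s : seq gen) : DA_alg a b := \prod_(x <- s) named a b x.

(* The strand k on the left of a crossing goes down, so it has the
   smaller slope and is the top strand. *)
Definition degree a (x : gen) : Gamma :=
  match x with
  | inl t => if ev F t is Cross k then mu t k - mu t k.+1 else gamma
  | inr (i, j) => mu a i - mu a j - gamma
  end.

Definition dgen a b (x : gen) : DA_alg a b :=
  match x with
  | inl v => (if is_rcusp (ev F v) then 1 else 0)
             + \sum_(D : {set cell F} | Disk a b v D) word a b (boundary a b D)
             + \sum_(D : {set cell F} | HalfD a b v D) word a b (boundary a b D)
  | inr (i, j) => \sum_(i.+1 <= k < j) named a b (inr (i, k)) * named a b (inr (k, j))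
  end.

Definition DA a b : predga Gamma :=
  @Predga Gamma
    (@Pregraded Gamma (DA_alg a b) (fcomp (fun x : gens a b => degree a (val x))))
    (fder (fun x : gens a b => dgen a b (val x))).

(* The algebra of the line at slice a: the generators are the rho_ij. *)
Definition I_ a : predga Gamma := DA a a.

Definition A_ a : predga Gamma := DA 0 a.
Definition D_ a : predga Gamma := DA a (size F).
Definition Ch : predga Gamma := DA 0 (size F).

Definition wsum a b i j : DA_alg a b :=
  \sum_(D : {set cell F} | HalfDA a b i j D) word a b (boundary a b D).

Definition incl a b a' b' : DA a b -> DA a' b' :=
  fext (fun x : gens a b => named a' b' (val x)).

(* w : I'_m -> DA(L) for L = (a, b). *)
Definition w_line a b : I_ b -> DA a b :=
  fext (fun x : gens b b =>
    if val x is inr (i, j) then wsum a b i j else 0).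

(* For K1 = (a0, a1) and K2 = (a1, b), the map DA(K2) -> DA(K12) fixing the vertices
   and replacing rho_ij by w(rho_ij). *)
Definition w_glue a0 a1 b : DA a1 b -> DA a0 b :=
  fext (fun x : gens a1 b =>
    match val x with
    | inl t => named a0 b (inl t)
    | inr (i, j) => @incl a0 a1 a0 b (wsum a0 a1 i j)
    end).

End Pieces.

Arguments incl {Gamma} gamma F mu a b a' b' _.
Arguments w_line {Gamma} gamma F mu a b _.
Arguments w_glue {Gamma} gamma F mu a0 a1 b _.

(* Main.v *)
From HB Require Import structures.
From mathcomp Require Import all_boot all_order all_algebra.
From mathcomp Require Import boolp finmap zify.
From mathcomp.multinomials Require Import monalg.
Require Import Defs.

(** The generators of the algebra of a piece are the line generators of its left
    end together with its vertices, so before passing to characteristic algebras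
    each square is a pushout of free algebras: the corner on the lower right is
    freely generated by the generators of the corner on the lower left together
    with the vertices of the last region.  [free_pushout] says when this survives
    the division by the image of the differential.  All four maps must carry
    differentials of generators into the ideals generated by the images of the
    differentials, and the differential of each generator of the last algebra must
    come from one of the two middle ones.  Ideals generated by homogeneous elements
    being homogeneous, the four quotients are graded.

    What remains is geometry.  As a disk has a unique right and a unique left end,
    its slices are intervals of gaps, and a half-disk of the piece [(a, t.+1)] is a
    half-disk of [(a, t)] extended across the singularity number [t].  Write [W t i
    j] for [half_sum], the sum of the boundary words of the half-disks of [(a, t)]
    that end between the strands [i] and [j] of slice [t], in an arbitrary ring in
    which the letters have values; it is the image of the line generator [(i, j)].
    There are few ways to extend, and they give a recursion for [W] (lemmas
    [half_sum_lcusp_], [half_sum_cross_] and [half_sum_rcusp]) that starts with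
    [W a i j] equal to the letter [(i, j)].  A disk ending at a vertex is a half-disk
    ending between the two strands that meet there ([vertex_sum]), so differentials
    of vertices are values of [W] as well.  Everything follows from the recursion by
    induction on [t]:

    - the words [W] are homogeneous, by the properties of a Maslov potential
      ([half_sum_deg]);
    - replacing the letters of a dividing line by the values of [W] there gives the
      values of [W] for the larger piece ([half_sum_glue]), hence the gluing maps
      commute with the differential on vertices ([glue_dgen]);
    - in a ring of characteristic two in which the differentials of the generators
      vanish, the sum over [l] of [W t i l * W t l j] vanishes at the right end of a
      simple piece ([half_sum_quadratic]), which is the compatibility of the gluing
      maps with the differentials of the line generators.

    Simplicity enters only in the last point.  Crossing a right cusp forgets two
    strands, hence the two terms of the quadratic sum for these strands are missing
    on the right.  They vanish because one of the regions adjacent to the cusp is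
    unbounded, and half-disks contain no unbounded region.  An unbounded region may
    reach the outside only through later parts of the piece, so the induction claims
    the relation just for those pairs of strands between which no gap leads to an
    unbounded one on the right ([exits]); at the right end there are no such gaps.
    The first square is the case of the second one in which the middle region is
    empty. *)

Set Implicit Arguments.
Unset Strict Implicit.
Unset Printing Implicit Defensive.

Import GRing.Theory.
Local Open Scope ring_scope.

(** * Free algebras over the field with two elements *)

Section FreeModule.
Variable X : choiceType.
Implicit Types (p q : free X) (s : seq X).

Definition mon s : free X := \prod_(x <- s) fgen x.

Lemma monE s : mon s = << FMonom s >>.
Proof.
elim: s => [|x s IH]; rewrite /mon.
  rewrite big_nil.
  by congr (<< _ >>); apply/eqP; rewrite fmP; apply/eqP; rewrite fm1.
rewrite big_cons -/(mon s) IH /fgen malgM_def fgmulUU mulr1.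
congr (<< _ >>); apply/eqP; rewrite fmP; apply/eqP; by rewrite fmM fmU.
Qed.

Lemma F2_cases (c : 'F_2) : c = 0 \/ c = 1.
Proof. by case: c => [[|[|m]] Hm] //; [left|right]; apply: val_inj. Qed.

(** Every coefficient is 0 or 1, so the words span additively. *)
Lemma free_ind (P : free X -> Prop) :
  P 0 -> (forall p q, P p -> P q -> P (p + q)) -> (forall s, P (mon s)) ->
  forall p, P p.
Proof.
move=> P0 PD Pm p; rewrite (monalgE p); elim: (enum_fset _) => [|m r IH].
  by rewrite big_nil.
rewrite big_cons; apply: PD => //.
case: (F2_cases p@_m) => ->; first by rewrite monalgU0.
by rewrite -[m]fmK -monE.
Qed.

(** Evaluations, derivations and projections to homogeneous components are all of
    this form; it is additive if the group [V] has exponent two. *)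
Definition lin_ext (V : zmodType) (L : seq X -> V) (p : free X) : V :=
  \sum_(m <- msupp p) L (m : {fmonom X}) *+ (p@_m : 'F_2).

Lemma lin_extEw (V : zmodType) (L : seq X -> V) (d : {fset {fmonom X}}) p :
  (msupp p `<=` d)%fset ->
  lin_ext L p = \sum_(m <- d) L m *+ (p@_m : 'F_2).
Proof.
move=> le; rewrite /lin_ext (big_fset_incl _ le) // => m _.
by move/mcoeff_outdom ->.
Qed.

Lemma lin_extD (V : zmodType) (L : seq X -> V) : (forall v : V, v + v = 0) ->
  {morph lin_ext L : p q / p + q}.
Proof.
move=> V2 p q.
rewrite (lin_extEw L (msuppD_le p q)) (lin_extEw L (fsubsetUl (msupp p) (msupp q))).
rewrite (lin_extEw L (fsubsetUr (msupp p) (msupp q))) -big_split /=.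
apply: eq_bigr => m _; rewrite mcoeffD.
case: (F2_cases p@_m) => ->; case: (F2_cases q@_m) => ->.
- by rewrite addr0.
- by rewrite add0r mulr0n add0r.
- by rewrite addr0 mulr0n addr0.
- by rewrite mulr1n V2.
Qed.

Lemma lin_ext_mon (V : zmodType) (L : seq X -> V) s : lin_ext L (mon s) = L s.
Proof. by rewrite monE /lin_ext msuppU1 big_seq_fset1 mcoeffUU mulr1n. Qed.

Lemma lin_ext0 (V : zmodType) (L : seq X -> V) : lin_ext L 0 = 0.
Proof. by rewrite /lin_ext msupp0 big_seq_fset0. Qed.

End FreeModule.

Section Evaluation.
Variable X : choiceType.

Lemma double_char2 (R : pzRingType) : 1 + 1 = 0 :> R -> forall v : R, v + v = 0.
Proof. by move=> R2 v; rewrite -[v]mul1r -mulrDl R2 mul0r. Qed.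

Lemma addrr_free (p : free X) : p + p = 0.
Proof.
apply: (@double_char2 (free X : pzRingType)).
rewrite -(scale1r (1 : free X)) -scalerDl.
by rewrite (_ : 1 + 1 = 0 :> 'F_2) ?scale0r //; apply: val_inj.
Qed.

(** Unlike [fext], the values lie in any ring of characteristic two, with neither
    a chosen structure of algebra nor the assumption that it is nontrivial, since
    characteristic algebras may vanish. *)
Definition feval (R : pzRingType) (f : X -> R) : free X -> R :=
  lin_ext (fun s => \prod_(x <- s) f x).

Section Morphism.
Variables (R : pzRingType) (R2 : 1 + 1 = 0 :> R) (f : X -> R).

Let fevalD : {morph feval f : p q / p + q} := lin_extD _ (double_char2 R2).

Lemma feval_is_zmod_morphism : zmod_morphism (feval f).
Proof.
move=> p q; rewrite fevalD; congr (_ + _).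
rewrite (_ : - q = q); last by apply/eqP; rewrite eq_sym -addr_eq0 addrr_free.
by apply/eqP; rewrite -addr_eq0; apply/eqP; apply: double_char2.
Qed.

Lemma feval_mon s : feval f (mon s) = \prod_(x <- s) f x.
Proof. exact: lin_ext_mon. Qed.

Lemma feval_is_monoid_morphism : monoid_morphism (feval f).
Proof.
split; first by rewrite (_ : 1 = mon [::]) ?feval_mon /mon big_nil.
move=> p q; elim/free_ind: p => [|p1 p2 IH1 IH2|s].
- by rewrite mul0r /feval lin_ext0 mul0r.
- rewrite mulrDl; apply: etrans (fevalD _ _) _; apply: etrans (congr2 _ IH1 IH2) _.
  by apply: etrans (esym (mulrDl _ _ _)) _; congr (_ * _); apply: esym (fevalD _ _).
elim/free_ind: q => [|q1 q2 IH1 IH2|t].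
- by rewrite mulr0 /feval lin_ext0 mulr0.
- rewrite mulrDr; apply: etrans (fevalD _ _) _; apply: etrans (congr2 _ IH1 IH2) _.
  by apply: etrans (esym (mulrDr _ _ _)) _; congr (_ * _); apply: esym (fevalD _ _).
by rewrite -[mon s * mon t]big_cat -/(mon _) !feval_mon big_cat.
Qed.

Definition evaluation : {rmorphism free X -> R} :=
  HB.pack (feval f)
    (GRing.isZmodMorphism.Build _ _ (feval f) feval_is_zmod_morphism)
    (GRing.isMonoidMorphism.Build _ _ (feval f) feval_is_monoid_morphism).

Lemma evaluation_gen x : evaluation (fgen x) = f x.
Proof. by have := feval_mon [:: x]; rewrite /mon !big_seq1. Qed.

End Morphism.

Lemma rmorph_mon (R : pzRingType) (h : {rmorphism free X -> R}) s :
  h (mon s) = \prod_(x <- s) h (fgen x).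
Proof. exact: rmorph_prod. Qed.

Lemma free_rmorph_eq (R : pzRingType) (g h : {rmorphism free X -> R}) :
  (forall x, g (fgen x) = h (fgen x)) -> g =1 h.
Proof.
move=> gh; elim/free_ind => [|p q IHp IHq|s]; first by rewrite !rmorph0.
  by rewrite !rmorphD IHp IHq.
by rewrite !rmorph_mon; apply: eq_bigr.
Qed.

End Evaluation.

Lemma free_char2 (X : choiceType) : 1 + 1 = 0 :> free X.
Proof. exact: addrr_free. Qed.

Lemma scaleF2 (V : lmodType 'F_2) (c : 'F_2) (v : V) : c *: v = v *+ c.
Proof. by case: (F2_cases c) => ->; rewrite ?scale0r ?scale1r. Qed.

Arguments evaluation : simpl never.

Section FreeExtension.
Variables (X Y : choiceType) (f : X -> free Y).

Lemma fextE : fext f =1 evaluation (free_char2 Y) f.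
Proof. by move=> p; apply: eq_bigr => m _; apply: scaleF2. Qed.

Lemma fext_gen x : fext f (fgen x) = f x.
Proof. by rewrite fextE evaluation_gen. Qed.

Lemma rmorph_fext (R : pzRingType) (h : {rmorphism free Y -> R})
    (k : {rmorphism free X -> R}) :
  (forall x, h (f x) = k (fgen x)) -> forall p, h (fext f p) = k p.
Proof.
move=> hk p; rewrite fextE; move: p.
apply: (free_rmorph_eq (g := h \o evaluation (free_char2 Y) f)) => x.
by rewrite -hk -fext_gen fextE.
Qed.
End FreeExtension.

Section Derivation.
Variables (X : choiceType) (d : X -> free X).

Lemma fderE : fder d =1 lin_ext (leibniz d).
Proof. by move=> p; apply: eq_bigr => m _; apply: scaleF2. Qed.

Lemma fderD : {morph fder d : p q / p + q}.
Proof. by move=> p q; rewrite !fderE (lin_extD _ (@addrr_free X)). Qed.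

Lemma fder_mon s : fder d (mon s) = leibniz d s.
Proof. by rewrite fderE lin_ext_mon. Qed.

Lemma fder_gen x : fder d (fgen x) = d x.
Proof.
have := fder_mon [:: x]; rewrite /mon big_seq1 => ->.
by rewrite /= big_nil mulr1 mulr0 addr0.
Qed.
End Derivation.

(** * Quotient rings and homogeneous components *)

Section QuotientRing.
Variables (A : pzRingType) (S : A -> Prop).

Lemma quo_pi_eq x y : (quo_pi S x = quo_pi S y) <-> in_ideal S (x - y).
Proof.
split=> [/quo_eqP/asboolP //|Ixy].
by apply/quo_eqP/asboolP.
Qed.

Lemma quo_pi_eq0 x : (quo_pi S x = 0) <-> in_ideal S x.
Proof. by rewrite -[X in in_ideal S X](subr0 x); apply: (quo_pi_eq x 0). Qed.

Lemma quo_pi_is_zmod_morphism : zmod_morphism (quo_pi S).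
Proof. by move=> x y; rewrite /quo_pi pi_quo_add pi_quo_opp. Qed.

Lemma quo_pi_is_monoid_morphism : monoid_morphism (quo_pi S).
Proof. by split=> // x y; rewrite /quo_pi pi_quo_mul. Qed.

HB.instance Definition _ := GRing.isZmodMorphism.Build A (quo S) (quo_pi S)
  quo_pi_is_zmod_morphism.
HB.instance Definition _ := GRing.isMonoidMorphism.Build A (quo S) (quo_pi S)
  quo_pi_is_monoid_morphism.

Lemma quo_pi_surj (y : quo S) : exists x, y = quo_pi S x.
Proof. by elim/quotW: y => x; exists x. Qed.

Lemma quo_lift (R : pzRingType) (f : {rmorphism A -> R}) :
  (forall x, S x -> f x = 0) ->
  exists h : {rmorphism quo S -> R}, forall x, h (quo_pi S x) = f x.
Proof.
move=> f0; have f0I x : in_ideal S x -> f x = 0.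
  elim=> {x} [x /f0 //||x y _ fx _ fy|a x _ fx|a x _ fx]; rewrite ?rmorph0 //.
  - by rewrite rmorphD fx fy addr0.
  - by rewrite rmorphM fx mulr0.
  - by rewrite rmorphM fx mul0r.
pose h (y : quo S) := f (repr y).
have hE x : h (quo_pi S x) = f x.
  apply/eqP; rewrite -subr_eq0 -rmorphB; apply/eqP/f0I/quo_pi_eq.
  by rewrite /quo_pi reprK.
have hB : zmod_morphism h.
  move=> y z; case: (quo_pi_surj y) => a ->; case: (quo_pi_surj z) => b ->.
  by rewrite -rmorphB !hE rmorphB.
have hM : monoid_morphism h.
  split; first by rewrite -(rmorph1 (quo_pi S)) hE rmorph1.
  move=> y z; case: (quo_pi_surj y) => a ->; case: (quo_pi_surj z) => b ->.
  by rewrite -rmorphM !hE rmorphM.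
by exists (HB.pack h (GRing.isZmodMorphism.Build _ _ h hB)
  (GRing.isMonoidMorphism.Build _ _ h hM) : {rmorphism quo S -> R}).
Qed.
End QuotientRing.

Section Projections.
Variables (X : choiceType) (Gamma : zmodType) (deg : X -> Gamma).
Implicit Types (p q : free X) (s : seq X) (g h : Gamma).

Definition word_deg s := \sum_(x <- s) deg x.

Lemma fcomp0 g : fcomp deg g 0.
Proof. by move=> m; rewrite msupp0. Qed.

Lemma fcompD g p q : fcomp deg g p -> fcomp deg g q -> fcomp deg g (p + q).
Proof.
move=> Hp Hq m /(fsubsetP (msuppD_le p q)); rewrite in_fsetU.
by case/orP => [/Hp|/Hq].
Qed.

Lemma fcomp_sum g I (r : seq I) (P : pred I) (F : I -> free X) :
  (forall i, P i -> fcomp deg g (F i)) -> fcomp deg g (\sum_(i <- r | P i) F i).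
Proof. exact: (big_ind _ (fcomp0 g) (@fcompD g)). Qed.

Lemma fcomp_mon s : fcomp deg (word_deg s) (mon s).
Proof. by move=> m; rewrite monE msuppU1 in_fset1 => /eqP ->. Qed.

Lemma fcomp1 : fcomp deg 0 1.
Proof. by have := @fcomp_mon [::]; rewrite /mon /word_deg !big_nil. Qed.

Lemma fcomp_gen x : fcomp deg (deg x) (fgen x).
Proof. by have := @fcomp_mon [:: x]; rewrite /mon /word_deg !big_seq1. Qed.

Lemma fcompM g h p q :
  fcomp deg g p -> fcomp deg h q -> fcomp deg (g + h) (p * q).
Proof.
move=> Hp Hq m /msuppM_le [m1] [m2] [m1p m2q ->].
by rewrite fmM big_cat /= (Hp _ m1p) (Hq _ m2q).
Qed.

Definition homog_part g : free X -> free X :=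
  lin_ext (fun s => if word_deg s == g then mon s else 0).

Lemma homog_partD g : {morph homog_part g : p q / p + q}.
Proof. exact: lin_extD (@addrr_free X). Qed.

Lemma homog_part_mon g s :
  homog_part g (mon s) = if word_deg s == g then mon s else 0.
Proof. exact: lin_ext_mon. Qed.

Lemma homog_part0 g : homog_part g 0 = 0. Proof. exact: lin_ext0. Qed.

Lemma homog_part_sum g I (r : seq I) (P : pred I) (F : I -> free X) :
  homog_part g (\sum_(i <- r | P i) F i) = \sum_(i <- r | P i) homog_part g (F i).
Proof. exact: (big_morph _ (homog_partD g) (homog_part0 g)). Qed.

Lemma fcomp_homog_part g p : fcomp deg g (homog_part g p).
Proof.
elim/free_ind: p => [|p q Hp Hq|s]; first by rewrite homog_part0; apply: fcomp0.
  by rewrite homog_partD; apply: fcompD.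
rewrite homog_part_mon; case: eqP => [<-|_]; [exact: fcomp_mon | exact: fcomp0].
Qed.

Lemma lin_ext_id p : lin_ext (@mon X) p = p.
Proof.
elim/free_ind: p => [|p q Hp Hq|s]; first by rewrite lin_ext0.
  by rewrite (lin_extD _ (@addrr_free X)) Hp Hq.
exact: lin_ext_mon.
Qed.

Lemma homog_part_fcomp g h p :
  fcomp deg h p -> homog_part g p = if h == g then p else 0.
Proof.
move=> Hp; rewrite /homog_part /lin_ext big_seq.
under eq_bigr => m /Hp Hm do rewrite /word_deg Hm.
case: eqP => _; last by rewrite big1 // => m _; rewrite mul0rn.
by rewrite -big_seq -[RHS]lin_ext_id.
Qed.

Lemma sum_homog_part p :
  exists2 s : seq Gamma, uniq s & p = \sum_(g <- s) homog_part g p.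
Proof.
exists (undup [seq word_deg (m : {fmonom X}) | m <- msupp p]); first exact: undup_uniq.
rewrite -{1}[p]lin_ext_id /lin_ext /homog_part /lin_ext exchange_big /=.
rewrite [LHS]big_seq [RHS]big_seq; apply: eq_bigr => m mp.
have ms : word_deg m \in undup [seq word_deg (m' : {fmonom X}) | m' <- msupp p].
  by rewrite mem_undup; apply/mapP; exists m.
rewrite (bigD1_seq _ ms) ?undup_uniq //= eqxx big1 ?addr0 // => g /negPf; rewrite eq_sym => ->.
by rewrite mul0rn.
Qed.

Lemma homog_part_monl g s q :
  homog_part g (mon s * q) = mon s * homog_part (g - word_deg s) q.
Proof.
elim/free_ind: q => [|p q Hp Hq|t]; first by rewrite mulr0 !homog_part0 mulr0.
  rewrite mulrDr; apply: etrans (homog_partD _ _ _) _; apply: etrans (congr2 _ Hp Hq) _.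
  by apply: etrans (esym (mulrDr _ _ _)) _; congr (_ * _); apply: esym (homog_partD _ _ _).
rewrite -[mon s * mon t]big_cat -/(mon _) !homog_part_mon /word_deg big_cat /=.
rewrite [RHS]fun_if mulr0 -[mon s * mon t]big_cat -/(mon _) -/(word_deg _).
by rewrite [X in _ = if X then _ else _]eq_sym subr_eq addrC eq_sym.
Qed.
End Projections.

Section HomogeneousIdeals.
Variables (X : choiceType) (Gamma : zmodType) (deg : X -> Gamma).

Lemma homog_part_monr g s q :
  homog_part deg g (q * mon s) = homog_part deg (g - word_deg deg s) q * mon s.
Proof.
elim/free_ind: q => [|p q Hp Hq|t]; first by rewrite mul0r !homog_part0 mul0r.
  rewrite mulrDl; apply: etrans (homog_partD _ _ _ _) _.
  apply: etrans (congr2 _ Hp Hq) _.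
  by apply: etrans (esym (mulrDl _ _ _)) _; congr (_ * _); apply: esym (homog_partD _ _ _ _).
rewrite -[mon t * mon s]big_cat -/(mon _) !homog_part_mon /word_deg big_cat /=.
rewrite [RHS](fun_if ( *%R^~ _)) mul0r -[mon t * mon s]big_cat -/(mon _).
by rewrite [X in _ = if X then _ else _]eq_sym subr_eq eq_sym.
Qed.

Variable S : free X -> Prop.
Hypothesis S_hom : forall x, S x -> forall g, in_ideal S (homog_part deg g x).

(** The components of a product with a word are products of components with this
    word, so the elements all of whose components are in the ideal are closed under
    multiplication by words, and then by all elements. *)
Lemma ideal_homog_part x : in_ideal S x -> forall g, in_ideal S (homog_part deg g x).
Proof.
elim=> {x} [x /S_hom //||x y _ Hx _ Hy|a x _ Hx|a x _ Hx] g.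
- by rewrite homog_part0; apply: ideal_zero.
- by rewrite homog_partD; apply: ideal_add.
- elim/free_ind: a => [|a b Ha Hb|s].
  + by rewrite mul0r homog_part0; apply: ideal_zero.
  + by rewrite mulrDl homog_partD; apply: ideal_add.
  + by rewrite homog_part_monl; apply: ideal_mull.
- elim/free_ind: a => [|a b Ha Hb|s].
  + by rewrite mulr0 homog_part0; apply: ideal_zero.
  + by rewrite mulrDr homog_partD; apply: ideal_add.
  + by rewrite homog_part_monr; apply: ideal_mulr.
Qed.
End HomogeneousIdeals.

Section FreeDGA.
Variables (Gamma : zmodType) (gamma : Gamma).

Definition free_dga (X : choiceType) (deg : X -> Gamma) (d : X -> free X)
  : predga Gamma := @Predga Gamma (@Pregraded Gamma (free X) (fcomp deg)) (fder d).

HB.instance Definition _ (A : predga Gamma) :=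
  GRing.isZmodMorphism.Build A (char_alg A) (@char_proj Gamma A)
  (@quo_pi_is_zmod_morphism A (@im_diff Gamma A)).
HB.instance Definition _ (A : predga Gamma) :=
  GRing.isMonoidMorphism.Build A (char_alg A) (@char_proj Gamma A)
  (@quo_pi_is_monoid_morphism A (@im_diff Gamma A)).

Section OneAlgebra.
Variables (X : choiceType) (deg : X -> Gamma) (d : X -> free X).
Hypothesis d_deg : forall x, fcomp deg (deg x - gamma) (d x).
Notation A := (free_dga deg d).

(** On words the differential lowers the degree by [gamma], as it does on letters. *)
Lemma leibniz_deg s : fcomp deg (word_deg deg s - gamma) (leibniz d s).
Proof.
elim: s => [|x s IH] /=; first exact: fcomp0.
rewrite /word_deg big_cons; apply: fcompD.
  rewrite addrAC; apply: fcompM; [exact: d_deg | exact: fcomp_mon].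
by rewrite -addrA; apply: fcompM; [exact: fcomp_gen | exact: IH].
Qed.

Lemma im_diff_homog_part (x : A) g :
  im_diff x -> in_ideal (@im_diff _ A) (homog_part deg g x).
Proof.
case=> p -> /=; elim/free_ind: p => [|p q Hp Hq|s].
- by rewrite fderE lin_ext0 homog_part0; apply: ideal_zero.
- by rewrite fderD homog_partD; apply: ideal_add.
rewrite fder_mon (homog_part_fcomp _ (@leibniz_deg s)).
case: ifP => _; last exact: ideal_zero.
by apply: ideal_gen; exists (mon s); rewrite /= fder_mon.
Qed.

Lemma char_proj_surj (y : char_alg A) : exists x : A, y = char_proj x.
Proof. exact: quo_pi_surj. Qed.

Lemma char_proj_graded : is_graded_morphism (@char_proj Gamma A).
Proof. by move=> g x Hx; exists x. Qed.

(** The sum of the homogeneous components is direct in the quotient because the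
    ideal contains the homogeneous components of its elements. *)
Lemma char_free_graded : is_graded_algebra (char_alg A).
Proof.
have proj_hom := @char_proj_graded.
split.
- by rewrite -(rmorph1 (@char_proj Gamma A)) -rmorphD free_char2 rmorph0.
- by move=> g; exists 0; [exact: fcomp0 | rewrite -[RHS](rmorph0 (@char_proj Gamma A))].
- move=> g _ _ [x Hx ->] [y Hy ->]; exists (x + y); first exact: fcompD.
  by rewrite -[LHS](rmorphD (@char_proj Gamma A)).
- by exists 1; [exact: fcomp1 | rewrite -[RHS](rmorph1 (@char_proj Gamma A))].
- move=> g h _ _ [x Hx ->] [y Hy ->]; exists (x * y); first exact: fcompM.
  by rewrite -[LHS](rmorphM (@char_proj Gamma A)).
- move=> y; case: (char_proj_surj y) => x ->.
  case: (sum_homog_part deg x) => s _ xE.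
  exists s, (fun g => char_proj (homog_part deg g x : A)); split.
    by move=> g; apply/proj_hom/fcomp_homog_part.
  by rewrite {1}xE -[RHS](rmorph_sum (@char_proj Gamma A)).
move=> s f s_uniq f_hom f0 g gs.
have lift h : exists x : A, fcomp deg h x /\ f h = char_proj x.
  by case: (f_hom h) => x; exists x.
have [x xP] := @boolp.choice Gamma A _ lift.
have : in_ideal (@im_diff _ A) (\sum_(h <- s) x h).
  apply/quo_pi_eq0; rewrite -[quo_pi _ _]/(char_proj _) rmorph_sum -[RHS]f0.
  by apply: eq_bigr => h _; rewrite (xP h).2.
move=> /(ideal_homog_part (fun x Hx h => im_diff_homog_part h Hx)) /(_ g).
rewrite homog_part_sum (bigD1_seq g) //= (homog_part_fcomp _ (xP g).1) eqxx big1 ?addr0.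
  by move=> /quo_pi_eq0; rewrite (xP g).2.
by move=> h /negPf hg; rewrite (homog_part_fcomp _ (xP h).1) hg.
Qed.
End OneAlgebra.
End FreeDGA.

(** * Pushouts of characteristic algebras of free DGAs *)

Section FreePushout.
Variables (Gamma : zmodType) (gamma : Gamma).

(** By the Leibniz rule the image of the differential is in the ideal generated by
    the differentials of the letters, hence only these must be checked. *)
Lemma rmorph_fder0 (X : choiceType) (d : X -> free X) (R : pzRingType)
    (h : {rmorphism free X -> R}) :
  (forall x, h (d x) = 0) -> forall p, h (fder d p) = 0.
Proof.
move=> hd; elim/free_ind => [|p q Hp Hq|s].
- by rewrite fderE lin_ext0 rmorph0.
- rewrite fderD rmorphD; apply: etrans (congr2 _ Hp Hq) _; exact: addr0.
rewrite fder_mon; elim: s => [|x s IH] /=; first exact: rmorph0.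
rewrite rmorphD; apply: etrans (congr2 _ (rmorphM h _ _) (rmorphM h _ _)) _.
by rewrite hd IH mul0r mulr0 addr0.
Qed.

Lemma char_rmorph_eq (X : choiceType) (deg : X -> Gamma) (d : X -> free X)
    (R : pzRingType) (g h : {rmorphism char_alg (free_dga deg d) -> R}) :
  (forall x, g (char_proj (fgen x : free_dga deg d)) =
    h (char_proj (fgen x : free_dga deg d))) -> g =1 h.
Proof.
move=> gh y; case: (char_proj_surj y) => p ->.
exact: (@free_rmorph_eq X R (g \o @char_proj Gamma (free_dga deg d))
   (h \o @char_proj Gamma (free_dga deg d)) gh p).
Qed.

Lemma char_lift (X : choiceType) (deg : X -> Gamma) (d : X -> free X)
    (Q : pregraded Gamma) (v : {rmorphism free X -> Q}) :
  is_graded_algebra Q ->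
  (forall x, gr_comp (deg x) (v (fgen x))) -> (forall x, v (d x) = 0) ->
  exists h : {rmorphism char_alg (free_dga deg d) -> Q},
    is_graded_morphism h /\ forall p, h (char_proj p) = v p.
Proof.
move=> gQ v_deg v_d.
have [|h hE] := @quo_lift (free X) (@im_diff Gamma (free_dga deg d)) Q v.
  by move=> _ [p ->]; apply: rmorph_fder0.
exists h; split=> // g _ [p Hp ->].
rewrite [h _]hE -[p]lin_ext_id /lin_ext big_seq rmorph_sum.
apply: (big_ind (gr_comp g)) => [|x y Hx Hy|m mp].
- exact: gr_zero.
- exact: gr_add.
rewrite -(Hp m mp) rmorphMn rmorph_mon.
case: (F2_cases p@_m) => ->; first by rewrite mulr0n; apply: gr_zero.
rewrite mulr1n; elim: {mp} (m : seq X) => [|x s IH].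
  by rewrite !big_nil; apply: gr_one.
by rewrite !big_cons; apply: gr_mul.
Qed.

Lemma induced_map (X Y : choiceType) (degX : X -> Gamma) (degY : Y -> Gamma)
    (dX : X -> free X) (dY : Y -> free Y) (f : X -> free Y) :
  (forall y, fcomp degY (degY y - gamma) (dY y)) ->
  (forall x, fcomp degY (degX x) (f x)) ->
  (forall x, char_proj (fext f (dX x) : free_dga degY dY) = 0) ->
  exists cf : {rmorphism char_alg (free_dga degX dX) -> char_alg (free_dga degY dY)},
    is_graded_morphism cf /\
    forall p, cf (char_proj p) = char_proj (fext f p : free_dga degY dY).
Proof.
move=> dY_deg f_deg f_char.
pose v := @char_proj Gamma (free_dga degY dY) \o evaluation (free_char2 Y) f
  : {rmorphism free X -> char_alg (free_dga degY dY)}.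
have vE p : v p = char_proj (fext f p : free_dga degY dY) by rewrite fextE.
have [||h [hg hE]] := @char_lift X degX dX _ v (char_free_graded dY_deg).
- by move=> x; rewrite vE fext_gen; apply/char_proj_graded/f_deg.
- by move=> x; rewrite vE f_char.
by exists h; split=> // p; rewrite hE vE.
Qed.

Variables (XA XB XC XP : choiceType).
Variables (degA : XA -> Gamma) (degB : XB -> Gamma) (degC : XC -> Gamma)
  (degP : XP -> Gamma).
Variables (dA : XA -> free XA) (dB : XB -> free XB) (dC : XC -> free XC)
  (dP : XP -> free XP).
Variables (f : XA -> free XB) (g : XA -> free XC) (g' : XB -> free XP)
  (f' : XC -> free XP).
Notation A := (free_dga degA dA).
Notation B := (free_dga degB dB).
Notation C := (free_dga degC dC).
Notation P := (free_dga degP dP).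

Hypothesis dA_deg : forall x, fcomp degA (degA x - gamma) (dA x).
Hypothesis dB_deg : forall x, fcomp degB (degB x - gamma) (dB x).
Hypothesis dC_deg : forall x, fcomp degC (degC x - gamma) (dC x).
Hypothesis dP_deg : forall x, fcomp degP (degP x - gamma) (dP x).
Hypothesis f_deg : forall x, fcomp degB (degA x) (f x).
Hypothesis g_deg : forall x, fcomp degC (degA x) (g x).
Hypothesis g'_deg : forall x, fcomp degP (degB x) (g' x).
Hypothesis f'_deg : forall x, fcomp degP (degC x) (f' x).
Hypothesis f_char : forall x, char_proj (fext f (dA x) : B) = 0.
Hypothesis g_char : forall x, char_proj (fext g (dA x) : C) = 0.
Hypothesis g'_char : forall x, char_proj (fext g' (dB x) : P) = 0.
Hypothesis f'_char : forall x, char_proj (fext f' (dC x) : P) = 0.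
Hypothesis square : forall x, fext g' (f x) = fext f' (g x).

(** A generator of [P] comes from one of [C] or from one of [B], with its
    differential, and [side] chooses which; the generators of [B] which are not
    chosen come from [A].  Thus [P] is the amalgam of the generating sets. *)
Variable side : XP -> XC + XB.
Hypothesis sideP : forall x, match side x with
  | inl y => [/\ f' y = fgen x, degC y = degP x & dP x = fext f' (dC y)]
  | inr z => [/\ g' z = fgen x, degB z = degP x & dP x = fext g' (dB z)]
  end.
Hypothesis C_side : forall y, exists x, side x = inl y.
Hypothesis B_side : forall z,
  (exists x, side x = inr z) \/ (exists a, f a = fgen z).

(** A compatible pair of morphisms from [B] and [C] determines the values on the
    generators of [P], and each differential in [P] is the image of one in [B] or
    in [C], so that these values define a morphism on the characteristic algebra. *)
Theorem free_pushout : @char_pushout Gamma A B C P (fext f) (fext g) (fext g') (fext f').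
Proof.
have [cf [cf_gr cfE]] := induced_map dB_deg f_deg f_char.
have [cg [cg_gr cgE]] := induced_map dC_deg g_deg g_char.
have [cg' [cg'_gr cg'E]] := induced_map dP_deg g'_deg g'_char.
have [cf' [cf'_gr cf'E]] := induced_map dP_deg f'_deg f'_char.
exists cf, cg, cg', cf'; split; first by split.
split.
- by split; [exact: char_free_graded dA_deg | exact: char_free_graded dB_deg
            | exact: char_free_graded dC_deg | exact: char_free_graded dP_deg].
- by split.
- apply: (@char_rmorph_eq XA degA dA _ (cg' \o cf) (cf' \o cg)) => x.
  by rewrite /= cfE cg'E cgE cf'E !fext_gen square.
move=> Q p q gQ p_gr q_gr pq.
have Q2 : 1 + 1 = 0 :> Q := gr_char2 gQ.
pose v x : Q := match side x with
  | inl y => q (char_proj (fgen y : C)) | inr z => p (char_proj (fgen z : B)) end.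
pose ev := evaluation Q2 v.
have ev_f' c : ev (fext f' c) = q (char_proj (c : C)).
  apply: (rmorph_fext (k := q \o @char_proj Gamma C)) => y.
  case: (C_side y) => x xE.
  by have := sideP x; rewrite xE => -[-> _ _]; rewrite evaluation_gen /v xE.
have ev_g' b : ev (fext g' b) = p (char_proj (b : B)).
  apply: (rmorph_fext (k := p \o @char_proj Gamma B)) => z.
  case: (B_side z) => [[x xE]|[a aE]].
    by have := sideP x; rewrite xE => -[-> _ _]; rewrite evaluation_gen /v xE.
  rewrite -(fext_gen g') -aE square ev_f'.
  have := pq (char_proj (fgen a : A)).
  by rewrite cfE cgE !fext_gen => /esym.
have dC0 c : char_proj (dC c : C) = 0.
  by apply/quo_pi_eq0/ideal_gen; exists (fgen c); rewrite /= fder_gen.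
have dB0 b : char_proj (dB b : B) = 0.
  by apply/quo_pi_eq0/ideal_gen; exists (fgen b); rewrite /= fder_gen.
have [||h [h_gr hE]] := @char_lift XP degP dP Q ev gQ.
- move=> x; rewrite evaluation_gen /v.
  have := sideP x; case: (side x) => y [_ <- _].
    exact/q_gr/char_proj_graded/fcomp_gen.
  exact/p_gr/char_proj_graded/fcomp_gen.
- move=> x; have := sideP x; case: (side x) => y [_ _ ->].
    by rewrite ev_f' dC0 rmorph0.
  by rewrite ev_g' dB0 rmorph0.
exists h; split=> //.
- apply: (@char_rmorph_eq XB degB dB Q (h \o cg') p) => z.
  by rewrite /= cg'E hE ev_g'.
- apply: (@char_rmorph_eq XC degC dC Q (h \o cf') q) => z.
  by rewrite /= cf'E hE ev_f'.
move=> h' _ h'p h'q.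
apply: (@char_rmorph_eq XP degP dP Q h' h) => x.
rewrite hE evaluation_gen /v; have := sideP x; case: (side x) => y [yE _ _].
  by rewrite -yE -(fext_gen f') -cf'E h'q.
by rewrite -yE -(fext_gen g') -cg'E h'p.
Qed.
End FreePushout.

(** * Regions as families of intervals of gaps *)

Section Regions.
Local Open Scope nat_scope.
Variable F : seq event.
Hypothesis front : forall t, t < size F -> pos (ev F t) + nin (ev F t) <= width F t.
Implicit Types (D E : {set cell F}) (a b t s g h i j : nat).

Lemma widthS t : t < size F ->
  width F t.+1 = width F t - nin (ev F t) + nout (ev F t).
Proof.
by move=> tF; rewrite /width (take_nth (LCusp 0) tF) -cats1 foldl_cat.
Qed.

Lemma width_le t : t <= size F -> width F t <= (size F).*2.
Proof.
suff H : t <= size F -> width F t <= t.*2.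
  by move=> tF; apply: leq_trans (H tF) _; rewrite leq_double.
elim: t => [|t IH] tF; first by rewrite /width take0.
rewrite widthS //; have := IH (ltnW tF).
by case: (ev F t) => k /=; lia.
Qed.

Lemma occ_cell D (c : cell F) : occ D c.1 c.2 = (c \in D).
Proof.
apply/exists_inP/idP => [[c' c'D /andP[/eqP e1 /eqP e2]]|cD]; last by exists c; rewrite ?eqxx.
suff -> : c = c' by [].
by case: c c' e1 e2 {c'D} => c1 c2 [d1 d2] /= /val_inj -> /val_inj ->.
Qed.

Lemma occ_ex D t g : occ D t g ->
  exists2 c : cell F, c \in D & c.1 = t :> nat /\ c.2 = g :> nat.
Proof. by case/exists_inP => c cD /andP[/eqP e1 /eqP e2]; exists c. Qed.

Lemma occ_eq D E : (forall t g, occ D t g = occ E t g) -> D = E.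
Proof. by move=> DE; apply/setP => c; rewrite -!occ_cell DE. Qed.

Lemma occ_bound D t g : occ D t g -> t <= size F /\ g <= (size F).*2.
Proof. by case/occ_ex => c _ [<- <-]; split; rewrite -ltnS. Qed.

(** The gap [g] is just above the strand [g], whence the asymmetric bounds. *)
Definition seg i j g := i < g <= j.

Lemma occ_set (P : nat -> nat -> bool) t g :
  occ [set c : cell F | P c.1 c.2] t g = [&& t <= size F, g <= (size F).*2 & P t g].
Proof.
apply/idP/and3P => [H|[tF gF Ptg]].
  have [? ?] := occ_bound H; split=> //.
  by have [c] := occ_ex H; rewrite inE => ? [<- <-].
rewrite -[t](@inordK (size F) t) // -[g](@inordK (size F).*2 g) //.
by rewrite (occ_cell _ (inord t, inord g)) inE /= !inordK.
Qed.

Lemma segment_sliceP D t i j : j <= (size F).*2 ->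
  reflect (i < j /\ forall g, occ D t g = seg i j g) (segment_slice D t i j).
Proof.
move=> jF; apply: (iffP andP) => -[ij H]; split=> //.
  move=> g; have [gF|gF] := leqP g (size F).*2.
    by rewrite -[g](@inordK (size F).*2 g) //; exact: eqP (forallP H _).
  apply/idP/idP => [/occ_bound[_]|]; first by rewrite leqNgt gF.
  by rewrite /seg; lia.
by apply/forallP => g; rewrite H.
Qed.

Lemma empty_sliceP D t : reflect (forall g, occ D t g = false) (empty_slice D t).
Proof.
apply: (iffP forallP) => H; last by move=> g; rewrite H.
move=> g; apply/negbTE/negP => H'; have [_ gF] := occ_bound H'.
by have := H (inord g); rewrite inordK // H'.
Qed.

(** The content of [disk_like], with quantifiers over all natural numbers: beyond
    the bounds of the type of cells there is nothing to check, as the number of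
    strands does not exceed these bounds. *)
Record region a b D : Prop := Region {
  region_in : forall s g, occ D s g -> a <= s <= b /\ 0 < g < width F s;
  region_conv : forall s g1 g2 g, occ D s g1 -> occ D s g2 -> g1 <= g <= g2 -> occ D s g;
  region_face : forall s g h, a <= s < b -> same_face (ev F s) g h ->
    occ D s g = occ D s.+1 h;
  region_cross : forall s, a <= s < b -> is_cross (ev F s) -> ~~ right_end D s ->
    nonsingular D s || corner D s }.

Lemma disk_likeP a b D : b <= size F -> reflect (region a b D) (disk_like a b D).
Proof.
move=> bF; apply: (iffP and4P) => [[H1 H2 H3 H4]|[H1 H2 H3 H4]].
  have Hin s g : occ D s g -> a <= s <= b /\ 0 < g < width F s.
    by case/occ_ex => c cD [<- <-]; apply/andP/(forall_inP H1).
  split=> //.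
  - move=> s g1 g2 g o1 o2 gg; have [sF g2F] := occ_bound o2.
    have [_ g1F] := occ_bound o1.
    have E1 n : n <= (size F).*2 -> n = (inord n : 'I_(size F).*2.+1) by move=> ?; rewrite inordK.
    have ES : s = (inord s : 'I_(size F).+1) by rewrite inordK.
    have gF : g <= (size F).*2 by case/andP: gg => _ /leq_trans; apply.
    move: o1 o2; rewrite (E1 g1) // (E1 g2) // (E1 g) // ES.
    rewrite !(occ_cell D (inord s, inord _)) => o1 o2.
    have := forall_inP (forall_inP H2 _ o1) _ o2.
    move/forallP/(_ (inord s, inord g))/implyP; apply.
    by rewrite /= !eqxx /= !inordK.
  - move=> s g h sab; have sF : s < size F by lia.
    have [/andP[gF hF]|out] := boolP ((g <= (size F).*2) && (h <= (size F).*2)).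
      move=> fgh; have := forall_inP H3 (Ordinal sF) sab.
      move/forallP/(_ (inord g))/forallP/(_ (inord h))/implyP.
      by rewrite /= !inordK // => /(_ fgh) /eqP.
    move=> fgh.
    have W1 := width_le (ltnW sF); have W2 := width_le sF.
    have := widthS sF; have := front sF => Wf WS.
    have -> : occ D s g = false.
      apply/negbTE/negP => /Hin [_]; move: fgh out Wf WS; case: (ev F s) => k /=; lia.
    apply/esym/negbTE/negP => /Hin [_]; move: fgh out Wf WS; case: (ev F s) => k /=; lia.
  - move=> s sab cr re; have sF : s < size F by lia.
    by have := forall_inP H4 (Ordinal sF); rewrite /= sab cr re; apply.
split.
- by apply/forall_inP => c; rewrite -occ_cell => /H1 [-> ->].
- apply/forall_inP => c1; rewrite -occ_cell => o1.
  apply/forall_inP => c2; rewrite -occ_cell => o2.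
  apply/forallP => c; apply/implyP => /and3P[/eqP e1 /eqP e2 cc].
  by rewrite -occ_cell e1; apply: H2 o1 _ cc; rewrite e2.
- apply/forall_inP => t tab; apply/forallP => g; apply/forallP => h.
  by apply/implyP => fgh; rewrite (H3 _ _ _ tab fgh).
- by apply/forall_inP => t /and3P[? ? ?]; apply: H4.
Qed.

Lemma starts_at_cuspP a b D : b <= size F ->
  reflect ((forall g, occ D a g = false) /\ exists u, [/\ a <= u < b, is_lcusp (ev F u) &
    forall s, a <= s < b -> left_end D s = (s == u)]) (starts_at_cusp a b D).
Proof.
move=> bF; apply: (iffP andP) => -[/empty_sliceP Ha Hu]; split=> //.
  case/existsP: Hu => u /and3P[u1 u2 u3]; exists u; split=> // s sab.
  have sF : s < size F by lia.
  by have /eqP := forall_inP u3 (Ordinal sF) sab.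
case: Hu => u [u1 u2 u3]; have uF : u < size F by lia.
apply/existsP; exists (Ordinal uF); rewrite /= u1 u2.
by apply/forall_inP => t /u3 ->; apply/eqP.
Qed.

Lemma starts_at_lineP a b D : a <= b -> b <= size F ->
  reflect ((exists k l, [/\ k < l < width F a & forall g, occ D a g = seg k l g]) /\
    forall s, a <= s < b -> left_end D s = false) (starts_at_line a b D).
Proof.
move=> ab bF; have Wa : width F a <= (size F).*2 by apply: width_le; lia.
apply: (iffP andP) => -[H1 H2]; split.
- case/existsP: H1 => k /existsP[l] /segment_sliceP H.
  case: H => [|kl H]; first by rewrite ltnW // (leq_trans _ Wa).
  by exists k, l; rewrite kl /=.
- move=> s sab; have sF : s < size F by lia.
  by apply/negbTE; apply: (forall_inP H2 (Ordinal sF) sab).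
- case: H1 => k [l] [/andP[kl la] H]; have ka := ltn_trans kl la.
  apply/existsP; exists (Ordinal ka); apply/existsP; exists (Ordinal la).
  by apply/segment_sliceP => //=; lia.
- by apply/forall_inP => t /H2 ->.
Qed.

Definition starts a b D := starts_at_cusp a b D || starts_at_line a b D.

Lemma ends_at_lineP a b D i j : b <= size F -> j < width F b ->
  reflect [/\ i < j, forall g, occ D b g = seg i j g &
    forall s, a <= s < b -> right_end D s = false] (ends_at_line a b D i j).
Proof.
move=> bF jb; have Wb := width_le bF.
apply: (iffP andP) => [[/segment_sliceP H1 H2]|[ij H1 H2]].
  case: H1 => [|ij H1]; first by lia.
  split=> // s sab; have sF : s < size F by lia.
  by apply/negbTE; apply: (forall_inP H2 (Ordinal sF) sab).
split; first by apply/segment_sliceP => //; lia.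
by apply/forall_inP => t /H2 ->.
Qed.

End Regions.

(** * Extending a half-disk across one singularity *)

Section Growth.
Local Open Scope nat_scope.
Variable F : seq event.
Hypothesis front : forall t, t < size F -> pos (ev F t) + nin (ev F t) <= width F t.
Implicit Types (D E : {set cell F}) (a b t s g h i j : nat).

Lemma HalfDAP a b i j D : a <= b <= size F -> j < width F b ->
  reflect [/\ region a b D, i < j, forall g, occ D b g = seg i j g,
    forall s, a <= s < b -> right_end D s = false & starts a b D]
    (HalfDA a b i j D).
Proof.
case/andP => ab bF jb; apply: (iffP and3P).
  by case=> /(disk_likeP front a D bF) H1 /(ends_at_lineP a D i bF jb) [? ? ?] H3; split.
by case=> H1 H2 H3 H4 H5; split => //; [apply/disk_likeP | apply/ends_at_lineP].
Qed.

(** Read from left to right, a region appears only at a left end. *)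
Lemma empty_next a b D s : region a b D -> a <= s < b ->
  (forall g, occ D s g = false) -> left_end D s = false ->
  forall h, occ D s.+1 h = false.
Proof.
move=> [_ _ face _] sab D0 le h; apply/negbTE/negP => oh.
have {}face g : same_face (ev F s) g h -> False.
  by move=> /(face _ _ _ sab); rewrite D0 oh.
move: face le; rewrite /left_end /right_of /left_of /top_of /bottom_of !D0.
case: (ev F s) => k /= face.
- have [hk|hk] := eqVneq h k.+1; first by rewrite -hk oh.
  case: (leqP h k) => hk' _; first by apply: (face h); lia.
  by apply: (face h.-2); lia.
- have [hk|hk] := eqVneq h k.+1; first by rewrite -hk oh.
  by move=> _; apply: (face h); lia.
- move=> _; case: (leqP h k) => hk'; first by apply: (face h); lia.
  by apply: (face h.+2); lia.
Qed.

Section SameSlices.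
Variables (D E : {set cell F}) (s : nat).
Hypotheses (DE : forall g, occ D s g = occ E s g)
  (DES : forall g, occ D s.+1 g = occ E s.+1 g).

Lemma right_end_eq : right_end D s = right_end E s.
Proof. by rewrite /right_end /left_of /top_of /bottom_of /right_of !DE DES. Qed.
Lemma left_end_eq : left_end D s = left_end E s.
Proof. by rewrite /left_end /left_of /top_of /bottom_of /right_of !DE DES. Qed.
Lemma nonsingular_eq : nonsingular D s = nonsingular E s.
Proof. by rewrite /nonsingular /left_of /top_of /bottom_of /right_of !DE DES. Qed.
Lemma corner_eq : corner D s = corner E s.
Proof. by rewrite /corner /left_of /top_of /bottom_of /right_of !DE DES. Qed.
End SameSlices.

(** The conditions that a half-disk must satisfy at the singularity [e] if its
    slices on the left and on the right of [e] are the segments [(i', j')] and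
    [(i, j)]: [e] is neither a left nor a right end, and a crossing is smooth or has
    one corner. *)
Record compat e i' j' i j : Prop := Compat {
  compat_face : forall g h, same_face e g h -> seg i' j' g = seg i j h;
  compat_end : match e with
    | LCusp k => ~~ (seg i j k.+1 && ~~ seg i' j' k)
    | Cross k =>
      let: T := seg i' j' k in let: B := seg i' j' k.+2 in
      let: L := seg i' j' k.+1 in let: R := seg i j k.+1 in
      [&& ~~ [&& L, ~~ T, ~~ B & ~~ R], ~~ [&& R, ~~ T, ~~ B & ~~ L] &
        [|| (T == R) && (B == L), (T == L) && (B == R) | T + B + L + R == 1]]
    | RCusp k => ~~ (seg i' j' k.+1 && ~~ seg i' j' k)
    end }.

(** The two operations behind the recursion; on half-disks of [(a, t.+1)] that end
    with the segment [(i, j)] they are inverse to each other. *)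
Definition cut t D := [set c : cell F | occ D c.1 c.2 && (c.1 <= t)].
Definition grow t i j D :=
  [set c : cell F | occ D c.1 c.2 || (c.1 == t.+1 :> nat) && seg i j c.2].

Lemma occ_cut t D s g : occ (cut t D) s g = occ D s g && (s <= t).
Proof.
rewrite (@occ_set F (fun s g => occ D s g && (s <= t))).
by case: (boolP (occ D s g)) => [/occ_bound[-> ->]|]; rewrite ?andbF.
Qed.

Lemma occ_grow t i j D s g : t < size F -> j < width F t.+1 ->
  occ (grow t i j D) s g = occ D s g || (s == t.+1) && seg i j g.
Proof.
move=> tF jW; have W := width_le tF.
rewrite (@occ_set F (fun s g => occ D s g || (s == t.+1) && seg i j g)).
case: (boolP (occ D s g)) => [/occ_bound[-> ->] //|_] /=.
by rewrite /seg; lia.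
Qed.

Section Step.
Variables (a t i j i' j' : nat) (D E : {set cell F}).
Hypotheses (at_ : a <= t) (tF : t < size F).
Hypotheses (ij : i < j) (jW : j < width F t.+1) (ij' : i' < j') (jW' : j' < width F t).
Hypothesis c : compat (ev F t) i' j' i j.
Hypothesis DE : forall s g, s <= t -> occ D s g = occ E s g.
Hypothesis Dt : forall g, occ D t g = seg i' j' g.
Hypothesis DtS : forall g, occ D t.+1 g = seg i j g.
Hypothesis D0 : forall s g, t.+1 < s -> occ D s g = false.
Hypothesis E0 : forall s g, t < s -> occ E s g = false.

Lemma step_ends : (right_end D t = false) * (left_end D t = false).
Proof.
case: c => _; rewrite /right_end /left_end /left_of /top_of /bottom_of /right_of.
rewrite !Dt !DtS; case: (ev F t) => k /=; first by move/negbTE ->.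
- by case/and3P => /negbTE -> /negbTE ->.
- by move/negbTE ->.
Qed.

Lemma step_before s : s < t ->
  [/\ right_end D s = right_end E s, left_end D s = left_end E s,
      nonsingular D s = nonsingular E s & corner D s = corner E s].
Proof.
move=> st; have H1 g : occ D s g = occ E s g by apply/DE/ltnW.
have H2 g : occ D s.+1 g = occ E s.+1 g by apply: DE.
by split; [apply: right_end_eq | apply: left_end_eq | apply: nonsingular_eq | apply: corner_eq].
Qed.

Lemma step_region : region a t.+1 D <-> region a t E.
Proof.
case: (c) => cf ce; have [re le] := step_ends.
split=> -[H1 H2 H3 H4]; split.
- move=> s g o; have [st|st] := leqP s t; last by rewrite E0 in o.
  by rewrite -DE // in o; have := H1 _ _ o; lia.
- move=> s g1 g2 g o1 o2; have [st|st] := leqP s t; last by rewrite E0 in o1.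
  by rewrite -!DE // in o1 o2 *; apply: H2 o1 o2.
- move=> s g h /andP[as_ st] fgh; rewrite -!DE //; last by lia.
  by apply: H3 => //; lia.
- move=> s /andP[as_ st] cr; have [<- _ <- <-] := step_before st.
  by apply: H4 => //; lia.
- move=> s g o; have [st|st] := leqP s t.
    by rewrite DE // in o; have := H1 _ _ o; lia.
  have [st1|st1] := ltnP t.+1 s; first by rewrite D0 in o.
  have es : s = t.+1 by lia.
  by rewrite es in o *; rewrite DtS /seg in o; lia.
- move=> s g1 g2 g o1 o2 gg; have [st|st] := leqP s t.
    by rewrite !DE // in o1 o2 *; apply: H2 o1 o2 gg.
  have [st1|st1] := ltnP t.+1 s; first by rewrite D0 in o1.
  have es : s = t.+1 by lia.
  by rewrite es in o1 o2 *; rewrite !DtS /seg in o1 o2 *; lia.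
- move=> s g h /andP[as_ st] fgh; have [st'|st'] := ltnP s t.
    by rewrite !DE; [apply: H3 => //| |]; lia.
  have es : s = t by lia.
  by rewrite es in fgh *; rewrite Dt DtS; apply: cf.
- move=> s /andP[as_ st] cr; have [st'|st'] := ltnP s t.
    by have [-> _ -> ->] := step_before st'; apply: H4 => //; lia.
  have es : s = t by lia.
  move=> _; rewrite es in cr *; move: cr ce.
  rewrite /nonsingular /corner /left_of /top_of /bottom_of /right_of !Dt !DtS.
  by case: (ev F t) => // k _ /and3P[_ _]; rewrite orbA.
Qed.

Lemma step_starts : starts a t.+1 D = starts a t E.
Proof.
have [re le] := step_ends; have DEa g : occ D a g = occ E a g by apply: DE.
have LE s : s < t -> left_end D s = left_end E s by case/step_before.
congr orb.
- apply/starts_at_cuspP/starts_at_cuspP => // [|-[Ha [u [u1 u2 u3]]]|[Ha [u [u1 u2 u3]]]].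
  + exact: ltnW.
  + split=> [g|]; first by rewrite -DEa.
    have ut : u != t.
      by apply/eqP => ut; have := u3 t; rewrite le ut eqxx; move/(_ ltac:(lia)).
    exists u; split=> //; first by lia.
    by move=> s sab; rewrite -LE ?u3; lia.
  + split=> [g|]; first by rewrite DEa.
    exists u; split=> //; first by lia.
    move=> s sab; have [st|st] := ltnP s t; first by rewrite LE ?u3; lia.
    have -> : s = t by lia.
    by rewrite le; lia.
- apply/starts_at_lineP/starts_at_lineP; rewrite ?(ltnW tF) // ?leqW // => -[[k [l [kl H]]] H2].
  + split; first by exists k, l; split=> // g; rewrite -DEa.
    by move=> s sab; rewrite -LE ?H2; lia.
  + split; first by exists k, l; split=> // g; rewrite DEa.
    move=> s sab; have [st|st] := ltnP s t; first by rewrite LE ?H2; lia.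
    by have -> : s = t by lia.
Qed.

(** All conditions are local in the horizontal direction, so the ones on [D] are
    those on [E] and those at the singularity number [t], which are [c]. *)
Lemma step_halfDA : HalfDA a t.+1 i j D = HalfDA a t i' j' E.
Proof.
have [re le] := step_ends.
apply/HalfDAP/HalfDAP; rewrite ?at_ ?(ltnW tF) ?leqW //.
  case=> /step_region r _ _ H s; rewrite step_starts in s; split=> //.
  - by move=> g; rewrite -DE ?Dt.
  - by move=> u /andP[au ut]; have [<- _ _ _] := step_before ut; apply: H; lia.
case=> /step_region r _ _ H s; rewrite -step_starts in s; split=> //.
move=> u /andP[au ut]; have [ut'|ut'] := ltnP u t.
  by have [-> _ _ _] := step_before ut'; apply: H; lia.
by have -> : u = t by lia.
Qed.

(** A corner at the last crossing is met first on the upper boundary, which is read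
    from right to left, and last on the lower one. *)
Lemma step_boundary :
  boundary a t.+1 D =
  (if is_cross (ev F t) && corner D t && bottom_of D t then [:: inl t] else [::]) ++
  boundary a t E ++
  (if is_cross (ev F t) && corner D t && top_of D t then [:: inl t] else [::]).
Proof.
rewrite /boundary (_ : iota a (t.+1 - a) = rcons (iota a (t - a)) t); last first.
  by rewrite subSn // -addn1 iotaD /= subnKC // cats1.
rewrite filter_rcons.
have -> : [seq s <- iota a (t - a) | is_cross (ev F s) && corner D s] =
          [seq s <- iota a (t - a) | is_cross (ev F s) && corner E s].
  apply: eq_in_filter => s; rewrite mem_iota subnKC // => /andP[_ st].
  by have [_ _ _ ->] := step_before st.
set cs := [seq s <- iota a (t - a) | _].
have csP s : s \in cs -> s < t.
  by rewrite mem_filter mem_iota subnKC // => /andP[_ /andP[]].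
have -> : [seq p <- [seq (k, l) | k <- iota 0 (width F a), l <- iota 0 (width F a)]
            | segment_slice D a p.1 p.2] =
          [seq p <- [seq (k, l) | k <- iota 0 (width F a), l <- iota 0 (width F a)]
            | segment_slice E a p.1 p.2].
  apply: eq_filter => p; rewrite /segment_slice; congr andb.
  by apply: eq_forallb => g; rewrite DE.
have bE : [seq s <- rev cs | bottom_of D s] = [seq s <- rev cs | bottom_of E s].
  by apply: eq_in_filter => s; rewrite mem_rev => /csP st; rewrite /bottom_of DE // ltnW.
have tE : [seq s <- cs | top_of D s] = [seq s <- cs | top_of E s].
  by apply: eq_in_filter => s /csP st; rewrite /top_of DE // ltnW.
case: ifP => _ /=; last by rewrite bE tE cats0.
rewrite rev_rcons /= filter_rcons bE tE.
by case: ifP => _; case: ifP => _; rewrite ?map_rcons -?cats1 ?cats0 ?catA.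
Qed.
End Step.
End Growth.

(** * Recursion for the sums over half-disks *)

Section HalfDiskSums.
Variable F : seq event.
Hypothesis front : forall t, (t < size F)%N -> (pos (ev F t) + nin (ev F t) <= width F t)%N.
Variables (R : pzRingType) (f : gen -> R).
Implicit Types (D E : {set cell F}) (a b t s g h i j k : nat).

(** For the letters [f x = named F a b x] this is the image of the generator
    [(i, j)] of the line at slice [t]; other values of [f] are needed for gluing and
    for computing in characteristic algebras. *)
Definition half_sum a t i j : R :=
  \sum_(D : {set cell F} | HalfDA a t i j D) \prod_(x <- boundary a t D) f x.

(** Only one half-disk fits into a piece without singularities: the segment. *)
Lemma half_sum_line a i j : (a <= size F)%N -> (i < j < width F a)%N ->
  half_sum a a i j = f (inr (i, j)).
Proof.
move=> aF /andP[ij ja]; have W := width_le aF.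
pose D0 := [set c : cell F | (c.1 == a :> nat) && seg i j c.2].
have occ0 s g : occ D0 s g = (s == a) && seg i j g.
  rewrite (@occ_set F (fun s g => (s == a) && seg i j g)) /seg; lia.
have HD D : HalfDA a a i j D = (D == D0).
  apply/HalfDAP/eqP => //; rewrite ?leqnn //.
    case=> -[H1 _ _ _] _ H2 _ _; apply: occ_eq => s g; rewrite occ0.
    case: eqP => [->|sa]; first by rewrite H2.
    by apply/negbTE/negP => /H1; lia.
  move=> ->; split=> //.
  - split=> [s g|s g1 g2 g|s g h sa|s sa]; rewrite ?occ0 /seg.
    + by case: eqP => // ->; lia.
    + by case: eqP => // _; lia.
    + by exfalso; move: sa; lia.
    + by exfalso; move: sa; lia.
  - by move=> g; rewrite occ0 eqxx.
  - by move=> s; lia.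
  - apply/orP; right; apply/starts_at_lineP => //; split; last by move=> s; lia.
    by exists i, j; split; [lia|move=> g; rewrite occ0 eqxx].
rewrite /half_sum (big_pred1 D0) //.
rewrite /boundary subnn /= cats0.
set ps := [seq (k, l) | k <- _, l <- _].
have ps_uniq : uniq ps.
  by apply: allpairs_uniq; rewrite ?iota_uniq // => -[? ?] [? ?] _ _ [-> ->].
have -> : [seq p <- ps | segment_slice D0 a p.1 p.2] = [seq p <- ps | pred1 (i, j) p].
  apply: eq_in_filter => -[k l] /allpairsP[[k' l'] /= [k'W l'W [-> ->]]].
  rewrite mem_iota in l'W; apply/segment_sliceP/eqP; first by lia.
    case=> kl' H; have Hseg g : seg i j g = seg k' l' g by rewrite -H occ0 eqxx.
    have h1 : seg i j k'.+1 by rewrite Hseg /seg; lia.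
    have h2 : seg i j l' by rewrite Hseg /seg; lia.
    have h3 : seg k' l' i.+1 by rewrite -Hseg /seg; lia.
    have h4 : seg k' l' j by rewrite -Hseg /seg; lia.
    by move: h1 h2 h3 h4; rewrite /seg => *; congr (_, _); lia.
  by case=> -> ->; split=> // g; rewrite occ0 eqxx.
rewrite filter_pred1_uniq //; first by rewrite /= big_seq1.
by apply/allpairsP; exists (i, j); rewrite !mem_iota /= !add0n (ltn_trans ij ja).
Qed.

Let corner_weight (b : bool) t : R := if b then f (inl t) else 1.

(** Extension by a segment is a bijection from the half-disks ending at [(i', j')]
    onto those ending at [(i, j)] whose previous slice is [(i', j')].  The predicate
    [P] singles out the latter, as there may be two possible previous slices. *)
Lemma half_sum_grow a t i j i' j' (P : pred {set cell F}) :
  (a <= t < size F)%N -> (i < j < width F t.+1)%N -> (i' < j' < width F t)%N ->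
  compat (ev F t) i' j' i j ->
  (forall D, HalfDA a t.+1 i j D -> P D <-> forall g, occ D t g = seg i' j' g) ->
  let k := pos (ev F t) in
  let: T := seg i' j' k in let: B := seg i' j' k.+2 in
  let: L := seg i' j' k.+1 in let: Q := seg i j k.+1 in
  let: c := is_cross (ev F t) && (T + B + L + Q == 1)%N in
  \sum_(D | HalfDA a t.+1 i j D && P D) \prod_(x <- boundary a t.+1 D) f x =
  corner_weight (c && B) t * half_sum a t i' j' * corner_weight (c && T) t.
Proof.
case/andP => at_ tF /andP[ij jW] /andP[ij' jW'] cpt HP k.
set c := _ && (_ == 1)%N.
have W' := width_le (ltnW tF).
have occG E s g : occ (grow t i j E) s g = occ E s g || (s == t.+1) && seg i j g.
  exact: occ_grow.
have HE E : HalfDA a t i' j' E -> [/\ forall s g, (t < s)%N -> occ E s g = false,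
     forall g, occ E t g = seg i' j' g & cut t (grow t i j E) = E].
  case/HalfDAP; rewrite ?at_ ?(ltnW tF) // => -[H1 _ _ _] _ H2 _ _.
  have E0 s g : (t < s)%N -> occ E s g = false.
    by move=> ts; apply/negbTE/negP => /H1; lia.
  split=> //; apply: occ_eq => s g; rewrite occ_cut occG.
  have [st|st] := leqP s t; last by rewrite andbF E0.
  by rewrite andbT ltn_eqF ?orbF.
have HG D E : (D = grow t i j E) -> (forall s g, (t < s)%N -> occ E s g = false) ->
    (forall g, occ E t g = seg i' j' g) ->
    [/\ forall s g, (s <= t)%N -> occ D s g = occ E s g,
     forall g, occ D t g = seg i' j' g, forall g, occ D t.+1 g = seg i j g &
     forall s g, (t.+1 < s)%N -> occ D s g = false].
  move=> -> E0 Et; split=> [s g st|g|g|s g st]; rewrite occG.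
  - by rewrite ltn_eqF ?orbF.
  - by rewrite ltn_eqF ?orbF.
  - by rewrite E0 // eqxx.
  - by rewrite E0 ?(ltnW st) // gtn_eqF.
rewrite (reindex_onto (grow t i j) (cut t)) /=; last first.
  move=> D /andP[HD PD]; apply: occ_eq => s g; rewrite occG occ_cut.
  case/HalfDAP: HD; rewrite ?leqW // => -[H1 _ _ _] _ H2 _ _.
  have [st|st] := leqP s t.
    by rewrite andbT ltn_eqF ?orbF.
  case: eqP => [->|st']; first by rewrite H2 andbF.
  by rewrite andbF; apply/esym/negbTE/negP => /H1; lia.
rewrite /half_sum big_distrr /= big_distrl /=.
apply: etrans (eq_bigl _ _ _) _; last apply: eq_bigr => E HDE.
  move=> E; apply/andP/idP => [[/andP[H1 H2] /eqP H3]|HDE].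
    have E0 s g : (t < s)%N -> occ E s g = false.
      by move=> ts; rewrite -H3 occ_cut; lia.
    have Et g : occ E t g = seg i' j' g.
      by rewrite -H3 occ_cut leqnn andbT; apply: (HP _ H1).1.
    have [G1 G2 G3 G4] := HG _ E erefl E0 Et.
    by rewrite -(step_halfDA front at_ tF ij jW ij' jW' cpt G1 G2 G3 G4 E0).
  have [E0 Et EK] := HE _ HDE; have [G1 G2 G3 G4] := HG _ E erefl E0 Et.
  have H1 : HalfDA a t.+1 i j (grow t i j E).
    by rewrite (step_halfDA front at_ tF ij jW ij' jW' cpt G1 G2 G3 G4 E0).
  by rewrite H1 EK eqxx; split=> //; apply/HP.
have [E0 Et EK] := HE _ HDE; have [G1 G2 G3 G4] := HG _ E erefl E0 Et.
rewrite (step_boundary at_ G1).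
rewrite /corner /left_of /top_of /bottom_of /right_of !G2 !G3 -/k -/c.
by rewrite !big_cat /= /corner_weight; case: ifP => _; case: ifP => _;
  rewrite ?big_seq1 ?big_nil ?mulrA.
Qed.

Lemma half_slice a t i j D : (a <= t < size F)%N -> (j < width F t.+1)%N ->
  HalfDA a t.+1 i j D ->
  [/\ forall g h, same_face (ev F t) g h -> occ D t g = seg i j h,
      forall g1 g2 g, occ D t g1 -> occ D t g2 -> (g1 <= g <= g2)%N -> occ D t g,
      right_end D t = false, ~~ is_lcusp (ev F t) -> left_end D t = false &
      is_cross (ev F t) -> nonsingular D t || corner D t].
Proof.
case/andP=> at_ tF jW HD.
case/HalfDAP: HD; rewrite ?leqW // => -[_ H2 H3 H4] ij DS re st.
have tt : (a <= t < t.+1)%N by rewrite at_ leqnn.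
split=> [g h fgh||||cr].
- by rewrite (H3 t g h) // DS.
- by move=> g1 g2 g; apply: H2.
- exact: re.
- move=> lc; case/orP: st => [/starts_at_cuspP|/starts_at_lineP] st.
    have [//|_ [u [u1 u2 u3]]] := st; rewrite u3 //.
    by apply/eqP => tu; rewrite tu u2 in lc.
  have [||_ ->] // := st; exact: leqW.
- by apply: H4 => //; rewrite re.
Qed.

Lemma half_sum_grow_unique a t i j i' j' :
  (a <= t < size F)%N -> (i < j < width F t.+1)%N -> (i' < j' < width F t)%N ->
  compat (ev F t) i' j' i j ->
  (forall D, HalfDA a t.+1 i j D -> forall g, occ D t g = seg i' j' g) ->
  let k := pos (ev F t) in
  let: T := seg i' j' k in let: B := seg i' j' k.+2 in
  let: L := seg i' j' k.+1 in let: Q := seg i j k.+1 in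
  let: c := is_cross (ev F t) && (T + B + L + Q == 1)%N in
  half_sum a t.+1 i j =
  corner_weight (c && B) t * half_sum a t i' j' * corner_weight (c && T) t.
Proof.
move=> h1 h2 h3 h4 H k; rewrite -(half_sum_grow (P := xpredT) h1 h2 h3 h4).
  by apply: eq_bigl => D; rewrite andbT.
by move=> D /H.
Qed.

(** A cusp between the strands [k] and [k.+1] renumbers the other strands: [skip k i]
    is the number, on the side with more strands, of the strand [i] of the other
    side. *)
Definition skip k i := (i + (k <= i).*2)%N.

(** A half-disk contains all gaps at the cusp or none: if it contained only the gap
    between the two strands then it would end at the cusp. *)
Lemma half_sum_rcusp a t i j k : (a <= t < size F)%N -> (i < j < width F t.+1)%N ->
  ev F t = RCusp k -> half_sum a t.+1 i j = half_sum a t (skip k i) (skip k j).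
Proof.
move=> at_ ij et; have W := widthS (andP at_).2; have Fr := front (andP at_).2.
apply: etrans (half_sum_grow_unique (i' := skip k i) (j' := skip k j) at_ ij _ _ _) _.
- by move: W Fr ij; rewrite et /skip /=; lia.
- by rewrite et; split=> [g h|]; rewrite /= /seg /skip; lia.
- move=> D HD g; have [|f1 f2 re _ _] := half_slice at_ _ HD; first by case/andP: ij.
  rewrite et /right_end et /left_of /top_of et /= in f1 re.
  have [gk|gk] := leqP g k; first by rewrite (f1 g g) /seg /skip; lia.
  have [gk'|gk'] := ltnP k.+1 g; first by rewrite (f1 g g.-2) /seg /skip; lia.
  have -> : g = k.+1 by lia.
  have T : occ D t k = seg i j k by apply: f1; lia.
  have B : occ D t k.+2 = seg i j k by apply: f1; lia.
  rewrite T in re; case: (boolP (seg i j k)) re => sk re.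
    rewrite (f2 k k.+2) ?T ?B //; last lia.
    by move: sk; rewrite /seg /skip; lia.
  by rewrite andbT in re; rewrite re; move: sk; rewrite /seg /skip; lia.
by rewrite et mul1r mulr1.
Qed.

Section Crossing.
Variables (a t k i j : nat).
Hypotheses (at_ : (a <= t < size F)%N) (et : ev F t = Cross k).
Hypothesis ij : (i < j < width F t.+1)%N.

(** Which of the left, top, bottom and right regions [L], [T], [B], [Q] at a crossing
    may belong to a half-disk.  The last condition is the convexity of the slice on
    the left. *)
Definition cross_ok (L T B Q : bool) :=
  [&& ~~ [&& L, ~~ T, ~~ B & ~~ Q], ~~ [&& Q, ~~ T, ~~ B & ~~ L],
    [|| (T == Q) && (B == L), (T == L) && (B == Q) | T + B + L + Q == 1]%N &
    T && B ==> L].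

Lemma cross_slice D : HalfDA a t.+1 i j D ->
  (forall g, g != k.+1 -> occ D t g = seg i j g) /\
  cross_ok (occ D t k.+1) (seg i j k) (seg i j k.+2) (seg i j k.+1).
Proof.
move=> HD; have [|f1 f2 re le cr] := half_slice at_ _ HD; first by case/andP: ij.
have fS g : g != k.+1 -> occ D t g = seg i j g.
  by move=> gk; apply: f1; rewrite et /= gk eqxx.
split=> //.
have DtS : occ D t.+1 k.+1 = seg i j k.+1.
  have [aF tF] := andP at_.
  by case/HalfDAP: HD; rewrite ?leqW //; case/andP: ij.
move: re (le ltac:(by rewrite et)) (cr ltac:(by rewrite et)).
rewrite /right_end /left_end /nonsingular /corner /left_of /top_of /bottom_of /right_of.
have kS : k != k.+1 by rewrite neq_ltn ltnSn.
have kSS : k.+2 != k.+1 by rewrite neq_ltn ltnSn orbT.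
have := f2 k k.+2 k.+1; rewrite et /= DtS !(fS _ kS) !(fS _ kSS) leqW //= => conv.
have {conv} : seg i j k && seg i j k.+2 ==> occ D t k.+1.
  by apply/implyP => /andP[T B]; apply: conv.
rewrite /cross_ok; case: (occ D t k.+1); case: (seg i j k); case: (seg i j k.+2);
  by case: (seg i j k.+1).
Qed.

Lemma half_sum_cross_filtered i' j' (l r : R) (P : pred bool) :
  (i' < j' < width F t)%N ->
  (forall g, g != k.+1 -> seg i' j' g = seg i j g) ->
  (forall L, cross_ok L (seg i j k) (seg i j k.+2) (seg i j k.+1) && P L =
     (L == seg i' j' k.+1)) ->
  l = corner_weight (seg i j k.+2 &&
    (seg i j k + seg i j k.+2 + seg i' j' k.+1 + seg i j k.+1 == 1)%N) t ->
  r = corner_weight (seg i j k &&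
    (seg i j k + seg i j k.+2 + seg i' j' k.+1 + seg i j k.+1 == 1)%N) t ->
  \sum_(D : {set cell F} | HalfDA a t.+1 i j D && P (occ D t k.+1))
     \prod_(x <- boundary a t.+1 D) f x = l * half_sum a t i' j' * r.
Proof.
have kS : k != k.+1 by rewrite neq_ltn ltnSn.
have kSS : k.+2 != k.+1 by rewrite neq_ltn ltnSn orbT.
move=> ij' seg' ok -> ->.
apply: etrans (half_sum_grow (i' := i') (j' := j') at_ ij ij' _ _) _.
- rewrite et; split=> /= [g h /andP[gk /eqP ->]|]; first exact: seg'.
  rewrite !(seg' _ kS) !(seg' _ kSS); have := ok (seg i' j' k.+1).
  by rewrite eqxx => /andP[/and4P[-> -> -> _] _].
- move=> D /cross_slice[H1 H2]; split=> [PD g|H].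
    have [->|gk] := eqVneq g k.+1; last by rewrite H1 // seg'.
    by have := ok (occ D t k.+1); rewrite H2 PD => /esym/eqP.
  by have := ok (occ D t k.+1); rewrite {3}H eqxx => /andP[].
by rewrite et /= !(seg' _ kS) !(seg' _ kSS) ![_ && seg i j _]andbC.
Qed.

Lemma half_sum_cross_unique i' j' (l r : R) :
  (i' < j' < width F t)%N ->
  (forall g, g != k.+1 -> seg i' j' g = seg i j g) ->
  (forall L, cross_ok L (seg i j k) (seg i j k.+2) (seg i j k.+1) =
     (L == seg i' j' k.+1)) ->
  l = corner_weight (seg i j k.+2 &&
    (seg i j k + seg i j k.+2 + seg i' j' k.+1 + seg i j k.+1 == 1)%N) t ->
  r = corner_weight (seg i j k &&
    (seg i j k + seg i j k.+2 + seg i' j' k.+1 + seg i j k.+1 == 1)%N) t ->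
  half_sum a t.+1 i j = l * half_sum a t i' j' * r.
Proof.
move=> ij' seg' ok lE rE; rewrite -(half_sum_cross_filtered (P := xpredT) ij' seg' _ lE rE).
  by apply: eq_bigl => D; rewrite andbT.
by move=> L; rewrite andbT.
Qed.

Lemma cross_width : (k.+1 < width F t)%N /\ width F t.+1 = width F t.
Proof.
clear i j ij; have tF := (andP at_).2; have := front tF; have := widthS tF.
by rewrite et /=; lia.
Qed.

Lemma half_sum_cross_keep : (j < k)%N || (k.+1 < i)%N || (i < k)%N && (k.+1 < j)%N ->
  half_sum a t.+1 i j = half_sum a t i j.
Proof.
have [kW W] := cross_width => h.
rewrite (@half_sum_cross_unique i j 1 1) ?mul1r ?mulr1 //; first by lia.
- by rewrite /cross_ok /seg; case; lia.
- by rewrite /seg /corner_weight ifF //; lia.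
- by rewrite /seg /corner_weight ifF //; lia.
Qed.

Lemma half_sum_cross_lower : (i < k)%N -> j = k.+1 ->
  half_sum a t.+1 i j = half_sum a t i k.
Proof.
have [kW W] := cross_width => ik jk.
rewrite (@half_sum_cross_unique i k 1 1) ?mul1r ?mulr1 //; first by lia.
- by move=> g; rewrite /seg; lia.
- by rewrite /cross_ok /seg; case; lia.
- by rewrite /seg /corner_weight ifF //; lia.
- by rewrite /seg /corner_weight ifF //; lia.
Qed.

Lemma half_sum_cross_upper : i = k -> (k.+1 < j)%N ->
  half_sum a t.+1 i j = half_sum a t k.+1 j.
Proof.
have [kW W] := cross_width => ik jk.
rewrite (@half_sum_cross_unique k.+1 j 1 1) ?mul1r ?mulr1 //; first by lia.
- by move=> g; rewrite /seg; lia.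
- by rewrite /cross_ok /seg; case; lia.
- by rewrite /seg /corner_weight ifF //; lia.
- by rewrite /seg /corner_weight ifF //; lia.
Qed.

(** A half-disk that ends in the right region alone would begin at the crossing or
    be pinched there. *)
Lemma half_sum_cross_zero : i = k -> j = k.+1 -> half_sum a t.+1 i j = 0.
Proof.
move=> ik jk; apply: big_pred0 => D; apply/negbTE/negP => /cross_slice[_].
by rewrite /cross_ok /seg; lia.
Qed.

(** If the half-disk is above the crossing, its lower boundary either follows the
    crossing strand or turns into the other one at a corner. *)
Lemma half_sum_cross_above : j = k ->
  half_sum a t.+1 i j = half_sum a t i k.+1 + half_sum a t i k * f (inl t).
Proof.
have [kW W] := cross_width => jk.
rewrite /half_sum (bigID (fun D : {set cell F} => occ D t k.+1)) /=; congr (_ + _).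
  rewrite (@half_sum_cross_filtered i k.+1 1 1 id) ?mul1r ?mulr1 //; first by lia.
  - by move=> g; rewrite /seg; lia.
  - by rewrite /cross_ok /seg; case; lia.
  - by rewrite /seg /corner_weight ifF //; lia.
  - by rewrite /seg /corner_weight ifF //; lia.
rewrite (@half_sum_cross_filtered i k 1 (f (inl t)) negb) ?mul1r //; first by lia.
- by move=> g; rewrite /seg; lia.
- by rewrite /cross_ok /seg; case; lia.
- by rewrite /seg /corner_weight ifF //; lia.
- by rewrite /seg /corner_weight ifT //; lia.
Qed.

Lemma half_sum_cross_below : i = k.+1 ->
  half_sum a t.+1 i j = half_sum a t k j + f (inl t) * half_sum a t k.+1 j.
Proof.
have [kW W] := cross_width => ik.
rewrite /half_sum (bigID (fun D : {set cell F} => occ D t k.+1)) /=; congr (_ + _).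
  rewrite (@half_sum_cross_filtered k j 1 1 id) ?mul1r ?mulr1 //; first by lia.
  - by move=> g; rewrite /seg; lia.
  - by rewrite /cross_ok /seg; case; lia.
  - by rewrite /seg /corner_weight ifF //; lia.
  - by rewrite /seg /corner_weight ifF //; lia.
rewrite (@half_sum_cross_filtered k.+1 j (f (inl t)) 1 negb) ?mulr1 //; first by lia.
- by move=> g; rewrite /seg; lia.
- by rewrite /cross_ok /seg; case; lia.
- by rewrite /seg /corner_weight ifT //; lia.
- by rewrite /seg /corner_weight ifF //; lia.
Qed.
End Crossing.

Section LeftCusp.
Variables (a t k : nat).
Hypotheses (at_ : (a <= t < size F)%N) (et : ev F t = LCusp k).

Lemma lcusp_width : (k <= width F t)%N /\ width F t.+1 = (width F t).+2.
Proof.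
have tF := (andP at_).2; have := front tF; have := widthS tF.
by rewrite et /=; lia.
Qed.

Lemma half_sum_lcusp_skip i j : (i < j < width F t)%N ->
  half_sum a t.+1 (skip k i) (skip k j) = half_sum a t i j.
Proof.
have [kW W] := lcusp_width => ij.
have ij' : (skip k i < skip k j < width F t.+1)%N by move: ij W; rewrite /skip; lia.
apply: etrans (half_sum_grow_unique (i' := i) (j' := j) at_ ij' ij _ _) _.
- by rewrite et; split=> [g h|]; rewrite /= /seg /skip; lia.
- move=> D HD g; have [|f1 _ _ _ _] := half_slice at_ _ HD; first by case/andP: ij'.
  rewrite et /= in f1.
  have [gk|gk] := leqP g k; first by rewrite (f1 g g) /seg /skip; lia.
  by rewrite (f1 g g.+2) /seg /skip; lia.
by rewrite et mul1r mulr1.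
Qed.

(** The regions above and below the cusp are the same, so a half-disk with an end at
    just one of the strands of the cusp is impossible. *)
Lemma half_sum_lcusp_zero i j : (i < j < width F t.+1)%N ->
  (k <= i <= k.+1)%N != (k <= j <= k.+1)%N -> half_sum a t.+1 i j = 0.
Proof.
have [kW W] := lcusp_width => ij ijk.
apply: big_pred0 => D; apply/negbTE/negP => HD.
have [|f1 _ _ _ _] := half_slice at_ _ HD; first by case/andP: ij.
rewrite et /= in f1.
have : seg i j k = seg i j k.+2 by rewrite -(f1 k k) -?(f1 k k.+2); lia.
by move: ij ijk; rewrite /seg; lia.
Qed.

(** The only half-disk is the one that begins at the cusp; it has no corners. *)
Lemma half_sum_lcusp_one : half_sum a t.+1 k k.+1 = 1.
Proof.
have [kW W] := lcusp_width; have [aT tF] := andP at_.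
pose D0 := [set c : cell F | (c.1 == t.+1 :> nat) && (c.2 == k.+1 :> nat)].
have W' := width_le tF.
have occ0 s g : occ D0 s g = (s == t.+1) && (g == k.+1).
  by rewrite (@occ_set F (fun s g => (s == t.+1) && (g == k.+1))); lia.
have occt s g : (s <= t)%N -> occ D0 s g = false by rewrite occ0; lia.
have loc0 s : (s < t)%N -> (right_end D0 s = false) * (left_end D0 s = false) *
    (nonsingular D0 s = true) * (corner D0 s = false).
  move=> st; rewrite /right_end /left_end /nonsingular /corner.
  rewrite /left_of /top_of /bottom_of /right_of !occt ?(ltnW st) //=.
  by case: (ev F s).
have let0 : left_end D0 t = true.
  by rewrite /left_end et /right_of /top_of et /= !occ0 !eqxx ltn_eqF.
have HD D : HalfDA a t.+1 k k.+1 D = (D == D0).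
  apply/idP/eqP => [HD|->].
    have [|f1 _ _ _ _] := half_slice at_ _ HD; first by rewrite W !ltnS.
    case/HalfDAP: HD; rewrite ?(leqW aT) ?W ?ltnS // => -[H1 H2 H3 H4] _ DS _ st.
    have Dt g : occ D t g = false.
      case: (leqP g k) => gk; first by rewrite (f1 g g) ?et /= /seg; lia.
      by rewrite (f1 g g.+2) ?et /= /seg; lia.
    have let1 : left_end D t = true.
      by rewrite /left_end et /right_of /top_of et /= Dt DS /seg !ltnSn.
    have tt : (a <= t < t.+1)%N by rewrite aT leqnn.
    have {st} [Da le] : (forall g, occ D a g = false) /\
        forall s, (a <= s < t)%N -> left_end D s = false.
      case/orP: st => [/starts_at_cuspP|/starts_at_lineP] st.
        have [//|Da [u [_ _ u3]]] := st; split=> // s sat.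
        have := u3 t tt; rewrite let1 => /esym/eqP tu.
        by rewrite u3 ?tu; lia.
      have [||_ H] := st; rewrite ?leqW //.
      by move: let1; rewrite H.
    (* The cusp is the unique left end, hence nothing can appear before it. *)
    have D_empty s : (a <= s <= t)%N -> forall g, occ D s g = false.
      elim: s => [|s IH] sat g.
        by have -> : 0%N = a by lia.
      have [sa|sa] := leqP a s; last by have -> : s.+1 = a by lia.
      have sat' : (a <= s < t.+1)%N by lia.
      by apply: (empty_next (a := a) (b := t.+1)) => //; [apply: IH | apply: le]; lia.
    apply: occ_eq => s g; rewrite occ0.
    case: eqP => [->|st]; first by rewrite DS /seg; lia.
    apply/negbTE/negP => o; have [sat _] := H1 _ _ o.
    by rewrite D_empty in o; lia.
  apply/HalfDAP; rewrite ?(leqW aT) ?W ?ltnS //; split=> //.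
  - split=> [s g|s g1 g2 g|s g h /andP[sa st] fgh|s /andP[sa st] cr _].
    + by rewrite occ0 => /andP[/eqP -> /eqP ->]; rewrite W; lia.
    + by rewrite !occ0; lia.
    + rewrite occt // occ0; case: eqP => // -[st'].
      by move: fgh; rewrite st' et /=; lia.
    + have [st'|st'] := ltnP s t; first by rewrite (loc0 s st').
      have tE : s = t by lia.
      by move: cr; rewrite tE et.
  - by move=> g; rewrite occ0 /seg; lia.
  - move=> s /andP[sa st]; have [st'|st'] := ltnP s t; first by rewrite (loc0 s st').
    have -> : s = t by lia.
    by rewrite /right_end et.
  - apply/orP; left; apply/starts_at_cuspP => //; split=> [g|]; first exact: occt.
    exists t; split; rewrite ?et ?aT //= => s /andP[sa st].
    have [st'|st'] := ltnP s t; first by rewrite (loc0 s st') ltn_eqF.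
    have -> : s = t by lia.
    by rewrite let0 eqxx.
rewrite /half_sum (big_pred1 D0) //.
suff -> : boundary a t.+1 D0 = [::] by rewrite big_nil.
rewrite /boundary.
have -> : [seq s <- iota a (t.+1 - a) | is_cross (ev F s) && corner D0 s] = [::].
  rewrite -(filter_pred0 (iota a (t.+1 - a))); apply: eq_in_filter => s.
  rewrite mem_iota subnKC ?(leqW aT) // => /andP[sa st].
  have [st'|st'] := ltnP s t; first by rewrite (loc0 s st') andbF.
  have -> : s = t by lia.
  by rewrite et.
rewrite /= cats0.
set ps := [seq (i, j) | i <- _, j <- _].
suff -> : [seq p <- ps | segment_slice D0 a p.1 p.2] = [::] by [].
rewrite -(filter_pred0 ps); apply: eq_in_filter => -[i j] /allpairsP[[i' j'] /=].
rewrite !mem_iota !add0n => -[_ j'W [-> ->]].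
have Wa : (width F a <= (size F).*2)%N by apply: width_le; lia.
apply/negbTE/negP => /segment_sliceP[|ij' /(_ j')]; first by lia.
by rewrite occt // /seg; lia.
Qed.
End LeftCusp.
End HalfDiskSums.

(** * Gluing half-disks along a dividing line *)

Section Gluing.
Variable F : seq event.
Hypothesis front : forall t, (t < size F)%N -> (pos (ev F t) + nin (ev F t) <= width F t)%N.

Variant lcusp_cases k n i j : Prop :=
| LCuspOne of i = k & j = k.+1
| LCuspZero of (k <= i <= k.+1)%N != (k <= j <= k.+1)%N
| LCuspSkip i' j' of (i' < j' < n)%N & i = skip k i' & j = skip k j'.

Lemma lcuspP k n i j : (k <= n)%N -> (i < j < n.+2)%N -> lcusp_cases k n i j.
Proof.
move=> kn ij.
have [/andP[/eqP ik /eqP jk]|h] := boolP ((i == k) && (j == k.+1)).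
  exact: LCuspOne.
have [h2|h2] := boolP ((k <= i <= k.+1)%N != (k <= j <= k.+1)%N).
  exact: LCuspZero.
apply: (@LCuspSkip _ _ _ _ (i - (k.+1 < i).*2) (j - (k.+1 < j).*2)).
- by lia.
- by rewrite /skip; lia.
- by rewrite /skip; lia.
Qed.

Variant cross_cases k i j : Prop :=
| CrossKeep of (j < k)%N || (k.+1 < i)%N || (i < k)%N && (k.+1 < j)%N
| CrossAbove of j = k
| CrossBelow of i = k.+1
| CrossLower of (i < k)%N & j = k.+1
| CrossUpper of i = k & (k.+1 < j)%N
| CrossZero of i = k & j = k.+1.

Lemma crossP k i j : (i < j)%N -> cross_cases k i j.
Proof.
move=> ij; have [jk|jk] := eqVneq j k; first exact: CrossAbove.
have [ik|ik] := eqVneq i k.+1; first exact: CrossBelow.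
have [jk1|jk1] := eqVneq j k.+1.
  have [ik'|ik'] := eqVneq i k; first exact: CrossZero.
  by apply: CrossLower => //; lia.
have [ik'|ik'] := eqVneq i k; first by apply: CrossUpper => //; lia.
by apply: CrossKeep; lia.
Qed.

Lemma rcusp_skip t k i j : (t < size F)%N -> ev F t = RCusp k ->
  (i < j < width F t.+1)%N -> (skip k i < skip k j < width F t)%N.
Proof.
by move=> tF et; have := front tF; rewrite widthS // et /skip /=; lia.
Qed.

(** Both sides satisfy the same recursion from slice [a1] on, where they agree. *)
Lemma half_sum_glue (R : pzRingType) (f f' : gen -> R) a0 a1 t i j :
  (a0 <= a1 <= t)%N -> (t <= size F)%N ->
  (forall s, f' (inl s) = f (inl s)) ->
  (forall i j, (i < j < width F a1)%N -> f' (inr (i, j)) = half_sum F f a0 a1 i j) ->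
  (i < j < width F t)%N -> half_sum F f' a1 t i j = half_sum F f a0 t i j.
Proof.
case/andP => a01 a1t tF f'l f'r; elim: t a1t tF i j => [|t IH] a1t tF i j ij.
  have a10 : a1 = 0%N by lia.
  by rewrite -a10 in tF ij *; rewrite half_sum_line // f'r.
have [a1t'|a1t'] := leqP a1 t; last first.
  have a1E : t.+1 = a1 by lia.
  by rewrite a1E in tF ij *; rewrite half_sum_line // f'r.
have {}IH := IH a1t' (ltnW tF).
have s0 : (a0 <= t < size F)%N by lia.
have s1 : (a1 <= t < size F)%N by lia.
case et: (ev F t) => [k|k|k].
- have [kW W] := lcusp_width front s0 et; rewrite W in ij.
  have [-> ->|h|i' j' ij' -> ->] := lcuspP kW ij.
  + by rewrite !(half_sum_lcusp_one front _ _ et).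
  + by rewrite !(half_sum_lcusp_zero front _ _ et) // W.
  + by rewrite !(half_sum_lcusp_skip front _ _ et) // IH.
- have [kW W] := cross_width front s0 et; rewrite W in ij.
  have [h|h|h|h h'|h h'|h h'] := crossP k (andP ij).1.
  + by rewrite !(half_sum_cross_keep front _ _ et) ?W // IH.
  + by rewrite !(half_sum_cross_above front _ _ et) ?W // f'l !IH //; lia.
  + by rewrite !(half_sum_cross_below front _ _ et) ?W // f'l !IH //; lia.
  + by rewrite !(half_sum_cross_lower front _ _ et) ?W // IH //; lia.
  + by rewrite !(half_sum_cross_upper front _ _ et) ?W // IH //; lia.
  + by rewrite !(half_sum_cross_zero front _ _ et) ?W.
- by rewrite !(half_sum_rcusp front _ _ _ et) // IH // (rcusp_skip tF et).
Qed.

End Gluing.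

(** * Disks ending at a vertex *)

Section VertexSums.
Variable F : seq event.
Hypothesis front : forall t, (t < size F)%N -> (pos (ev F t) + nin (ev F t) <= width F t)%N.
Implicit Types (D : {set cell F}).
Local Open Scope nat_scope.

Lemma ends_at_vertexP a b D v : b <= size F ->
  reflect [/\ a <= v < b, forall g, occ D b g = false &
    forall s, a <= s < b -> right_end D s = (s == v)] (ends_at_vertex a b D v).
Proof.
move=> bF; apply: (iffP and3P) => -[H1 /empty_sliceP H2 H3]; split=> //.
  move=> s sab; have sF : s < size F by lia.
  by have /eqP := forall_inP H3 (Ordinal sF) sab.
by apply/forall_inP => t /H3 ->.
Qed.

Section OneVertex.
Variables (a b v : nat).
Hypotheses (ab : a <= v < b) (bF : b <= size F) (nl : ~~ is_lcusp (ev F v)).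
Notation k := (pos (ev F v)).

Let av : a <= v. Proof. by case/andP: ab. Qed.
Let vF : v < size F. Proof. by apply: leq_trans bF; case/andP: ab. Qed.

Lemma vertex_width : k.+1 < width F v.
Proof. by have := front vF; move: nl; case: (ev F v) => k' //=; rewrite addn2. Qed.

(** At its right end a disk is just the gap between the two strands. *)
Lemma vertex_slice D : region a b D -> right_end D v ->
  (forall g, occ D v g = (g == k.+1)) /\ (forall g, occ D v.+1 g = false).
Proof.
move=> [_ conv face _] re.
have {}face g h : same_face (ev F v) g h -> occ D v g = occ D v.+1 h by apply: face.
have {conv} conv g1 g2 g : occ D v g1 -> occ D v g2 -> g1 <= g <= g2 -> occ D v g.
  exact: conv.
have [L T B] : [/\ occ D v k.+1, occ D v k = false & occ D v k.+2 = false].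
  move: re face nl; rewrite /right_end /left_of /top_of /bottom_of.
  case: (ev F v) => k' //=; first by case/and4P=> -> /negbTE -> /negbTE ->.
  case/andP=> -> /negbTE T face _; split=> //.
  by rewrite (face k'.+2 k') ?leqnn ?eqxx ?orbT // -(face k' k') ?leqnn ?eqxx.
have Dv g : occ D v g = (g == k.+1).
  case: (ltngtP g k.+1) => [gk|gk|->] //; apply/negbTE/negP => og.
    by have := conv _ _ k og L; rewrite T; lia.
  by have := conv _ _ k.+2 L og; rewrite B; lia.
split=> // g; move: re face Dv nl; rewrite /right_end /right_of.
case: (ev F v) => k' //=.
  case/and4P=> _ _ _ /negbTE R face Dv _.
  have [->|gk] := eqVneq g k'.+1; first exact: R.
  by rewrite -(face g g) ?Dv ?gk ?eqxx // (negbTE gk).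
move=> _ face Dv _; case: (leqP g k') => gk.
  by rewrite -(face g g) ?Dv; lia.
by rewrite -(face g.+2 g) ?Dv; lia.
Qed.

Lemma vertex_half D : region a v D -> (forall g, occ D v g = (g == k.+1)) ->
  region a b D /\ right_end D v /\ (forall s, v < s -> forall g, occ D s g = false).
Proof.
move=> [H1 H2 H3 H4] Dv.
have D0 s : v < s -> forall g, occ D s g = false.
  by move=> vs g; apply/negbTE/negP => /H1; lia.
have re : right_end D v.
  move: nl Dv; rewrite /right_end /left_of /top_of /bottom_of /right_of (D0 v.+1) //.
  by case: (ev F v) => k' //= _ Dv'; rewrite !Dv'; lia.
split=> //; split.
- by move=> s g /H1 H; lia.
- exact: H2.
- move=> s g h sab fgh; case: (ltngtP s v) => sv.
  + by apply: H3 => //; lia.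
  + by rewrite !D0 //; lia.
  + rewrite sv Dv D0 // in fgh *; move: fgh nl.
    by case: (ev F v) => k' //=; lia.
- move=> s sab cr nre; case: (ltngtP s v) => sv.
  + by apply: H4 => //; lia.
  + rewrite /nonsingular /corner /left_of /top_of /bottom_of /right_of !D0 //; lia.
  + by rewrite sv re in nre.
Qed.

Lemma left_end_after D s : (forall g, occ D s.+1 g = false) -> left_end D s = false.
Proof. by rewrite /left_end /right_of => ->; case: (ev F s). Qed.

Lemma right_end_after D s : (forall g, occ D s g = false) -> right_end D s = false.
Proof. by rewrite /right_end /left_of => ->; case: (ev F s). Qed.

(** The same set of cells is a disk of [(a, b)] with right end [v] and a half-disk
    of [(a, v)]: a disk has no cells to the right of its right end, since these would
    need a second left end. *)
Lemma half_vertexE D : HalfDA a v k k.+1 D = Disk a b v D || HalfD a b v D.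
Proof.
have kW := vertex_width.
have -> : Disk a b v D || HalfD a b v D =
    [&& disk_like a b D, ends_at_vertex a b D v & starts a b D].
  by rewrite /Disk /HalfD /starts -!andb_orr.
apply/HalfDAP/and3P => //; rewrite ?av ?(ltnW vF) //.
  case=> reg _ Dseg re st; have Dv g : occ D v g = (g == k.+1).
    by rewrite Dseg /seg; lia.
  have [regb [re_v D0]] := vertex_half reg Dv.
  have le0 s : v <= s -> left_end D s = false.
    by move=> vs; apply: left_end_after; apply: D0.
  split; first exact/disk_likeP.
    apply/ends_at_vertexP => //; split=> //; first by apply: D0; lia.
    move=> s sab; case: (ltngtP s v) => sv; last by rewrite sv re_v.
      by rewrite re //; lia.
    by apply: right_end_after; apply: D0.
  case/orP: st => st; apply/orP; [left|right].
    have [Da [u [u1 u2 u3]]] := elimT (@starts_at_cuspP F a v D (ltnW vF)) st.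
    apply/starts_at_cuspP => //; split=> //; exists u; split=> //; first by lia.
    move=> s sab; case: (ltnP s v) => sv; first by apply: u3; lia.
    by rewrite le0 //; lia.
  have [H1 H2] := elimT (@starts_at_lineP F a v D av (ltnW vF)) st.
  apply/starts_at_lineP; [lia|lia|split=> // s sab].
  case: (ltnP s v) => sv; first by apply: H2; lia.
  exact: le0.
case=> /(disk_likeP front a D bF) reg /(ends_at_vertexP _ _ _ bF)[_ Db re] st.
have re_v : right_end D v by rewrite re ?eqxx.
have [Dv DvS] := vertex_slice reg re_v.
have leb : a <= b by lia.
have [D0 st'] : (forall s, v < s <= b -> forall g, occ D s g = false) /\ starts a v D.
  case/orP: st => [/(elimT (@starts_at_cuspP F a b D bF))|/(elimT (@starts_at_lineP F a b D leb bF))].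
    case=> Da [u [u1 u2 u3]].
    (* Otherwise the slices would be empty up to the vertex. *)
    have uv : u < v.
      case: (ltngtP u v) => // uv; last by move: nl; rewrite -uv u2.
      suff /(_ v) : forall s, a <= s <= v -> forall g, occ D s g = false.
        by rewrite av leqnn => /(_ isT k.+1); rewrite Dv eqxx.
      elim=> [|s IH] sav g; first by have <- : a = 0 by lia.
      have [sa|sa] := leqP a s; last by have <- : a = s.+1 by lia.
      have sab : a <= s < b by lia.
      apply: (empty_next reg sab); first by apply: IH; lia.
      by rewrite u3 //; lia.
    split.
      elim=> [|s IH] sv g; first by lia.
      have [sv'|sv'] := leqP s v; first by have -> : s = v by lia.
      have sab : a <= s < b by lia.
      apply: (empty_next reg sab); first by apply: IH; lia.
      by rewrite u3 //; lia.
    apply/orP; left; apply/starts_at_cuspP; first exact: ltnW.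
    split=> //; exists u; split=> // [|s sab]; first by lia.
    by apply: u3; lia.
  case=> Dl le; split.
    elim=> [|s IH] sv g; first by lia.
    have [sv'|sv'] := leqP s v; first by have -> : s = v by lia.
    have sab : a <= s < b by lia.
    by apply: (empty_next reg sab); [apply: IH; lia | apply: le].
  apply/orP; right; apply/starts_at_lineP => //; first exact: ltnW.
  by split=> // s sab; apply: le; lia.
case: reg => H1 H2 H3 H4; split=> //.
- split=> [s g o|||].
  + have [sab ?] := H1 _ _ o; split=> //.
    by case: (leqP s v) => sv; [lia | rewrite D0 in o; lia].
  + exact: H2.
  + by move=> s g h sab; apply: H3; lia.
  + by move=> s sab; apply: H4; lia.
- by move=> g; rewrite Dv /seg; lia.
- by move=> s sab; rewrite re; lia.
Qed.

Lemma Disk_HalfD D : Disk a b v D -> HalfD a b v D = false.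
Proof.
have leb : a <= b by lia.
case/and3P=> _ _ /(elimT (@starts_at_cuspP F a b D bF)) [Da _].
apply/negbTE/negP => /and3P[_ _ /(elimT (@starts_at_lineP F a b D leb bF))].
by case=> -[i [j [/andP[ij _] H]]] _; have := H j; rewrite Da /seg; lia.
Qed.

(** The right end itself passes the test [corner], but as it occupies the left region
    it contributes no letter. *)
Lemma vertex_boundary D : HalfDA a v k k.+1 D -> boundary a b D = boundary a v D.
Proof.
have kW := vertex_width.
case/HalfDAP; rewrite ?av ?(ltnW vF) // => reg _ Dseg re st.
have Dv g : occ D v g = (g == k.+1) by rewrite Dseg /seg; lia.
have [regb [re_v D0]] := vertex_half reg Dv.
rewrite /boundary (_ : b - a = (v - a) + (b - v)); last by lia.
rewrite iotaD filter_cat subnKC //.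
set c1 := [seq s <- iota a _ | _]; set c2 := [seq s <- iota v _ | _].
have c2v s : s \in c2 -> (top_of D s = false) * (bottom_of D s = false).
  rewrite mem_filter mem_iota /top_of /bottom_of => /andP[_ /andP[vs _]].
  have [sv|vs'] := leqP s v; last by rewrite !D0.
  have -> : s = v by lia.
  by rewrite !Dv; split; lia.
have -> : [seq s <- c1 ++ c2 | top_of D s] = [seq s <- c1 | top_of D s].
  rewrite filter_cat [X in _ ++ X](_ : _ = [::]) ?cats0 //.
  by rewrite -(filter_pred0 c2); apply: eq_in_filter => s /c2v ->.
have -> // : [seq s <- rev (c1 ++ c2) | bottom_of D s] = [seq s <- rev c1 | bottom_of D s].
rewrite rev_cat filter_cat [X in X ++ _](_ : _ = [::]) //.
rewrite -(filter_pred0 (rev c2)); apply: eq_in_filter => s.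
by rewrite mem_rev => /c2v ->.
Qed.

Lemma vertex_sum (R : pzRingType) (f : gen -> R) :
  (\sum_(D : {set cell F} | Disk a b v D) \prod_(x <- boundary a b D) f x +
   \sum_(D : {set cell F} | HalfD a b v D) \prod_(x <- boundary a b D) f x)%R =
  half_sum F f a v k k.+1.
Proof.
rewrite /half_sum [RHS](bigID (Disk a b v)) /=.
congr (_ + _)%R.
  apply: eq_big => D; first by rewrite half_vertexE; case: (Disk a b v D); rewrite ?andbF.
  by move=> HD; rewrite vertex_boundary //; rewrite half_vertexE HD.
apply: eq_big => D; last by move=> HD; rewrite vertex_boundary // half_vertexE HD orbT.
rewrite half_vertexE; case: (boolP (Disk a b v D)) => [/Disk_HalfD ->|_] //=.
by rewrite andbT.
Qed.
End OneVertex.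
End VertexSums.

(** * The quadratic relation at a simple piece *)

Section QuadraticRelation.
Variable F : seq event.
Hypothesis front : forall t, (t < size F)%N -> (pos (ev F t) + nin (ev F t) <= width F t)%N.
Variables (a0 a1 : nat).
Hypotheses (a01 : (a0 <= a1)%N) (a1F : (a1 <= size F)%N).

Lemma big_skip (V : zmodType) (G : nat -> V) k i j : (i < j)%N ->
  \sum_((skip k i).+1 <= l < skip k j) G l =
  \sum_(i.+1 <= l < j) G (skip k l) + (if (i < k <= j)%N then G k + G k.+1 else 0).
Proof.
move=> ij; have [/andP[ik kj]|h] := boolP (i < k <= j)%N.
  have -> : skip k i = i by rewrite /skip; lia.
  have -> : skip k j = j.+2 by rewrite /skip; lia.
  rewrite (@big_cat_nat _ _ _ k) //=; last by lia.
  rewrite [\sum_(k <= l < _) _]big_ltn ?[\sum_(k.+1 <= l < _) _]big_ltn; try lia.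
  rewrite [in RHS](@big_cat_nat _ _ _ k) //= -[RHS]addrA; congr (_ + _).
    by apply: eq_big_nat => l lk; congr G; rewrite /skip; lia.
  rewrite [LHS]addrA [LHS]addrC; congr (_ + _).
  rewrite -[in LHS](addn2 k) -[in LHS](addn2 j) big_addn addnK.
  by apply: eq_big_nat => l lk; congr G; rewrite /skip; lia.
rewrite addr0; have [jk|kj] := ltnP j k.
  have -> : skip k i = i by rewrite /skip; lia.
  have -> : skip k j = j by rewrite /skip; lia.
  by apply: eq_big_nat => l lk; congr G; rewrite /skip; lia.
have -> : skip k i = (i + 2)%N by rewrite /skip; lia.
have -> : skip k j = (j + 2)%N by rewrite /skip; lia.
rewrite -addSn big_addn addnK.
by apply: eq_big_nat => l lk; congr G; rewrite /skip; lia.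
Qed.

(** The gaps of slice [t] through which one gets to an unbounded gap of the next
    slice.  A half-disk of [(a0, t)] can contain an unbounded gap only if it contains
    one of these: a path from this gap to the outside must leave [(a0, t)], because
    a half-disk contains each region that it meets and no outer one. *)
Definition exits t g := exists2 h, same_face (ev F t) g h & unbounded F a0 a1 t.+1 h.

Lemma unbounded_slice t g : unbounded F a0 a1 t g -> (a0 <= t <= a1)%N.
Proof. by elim=> // {}t {}g h; lia. Qed.

Lemma half_disk_bounded t i j (D : {set cell F}) : (a0 <= t <= a1)%N -> (j < width F t)%N ->
  HalfDA a0 t i j D -> (forall g, seg i j g -> ~ exits t g) ->
  forall s g, occ D s g -> ~ unbounded F a0 a1 s g.
Proof.
case/andP=> a0t ta1 jW HD nex.
case/HalfDAP: HD => //; first by rewrite a0t; lia.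
case=> H1 _ H3 _ _ Dt _ _ s g o u; elim: u o => {s g}.
- by move=> s _ /H1[].
- by move=> s _ /H1[_]; lia.
- move=> s g h sab _ fgh ug IH o; apply: IH.
  by have [st _] := H1 _ _ o; rewrite (H3 _ _ _ _ fgh) //; lia.
move=> s g h sab _ fgh uh IH o; have [st _] := H1 _ _ o.
have [st'|st'] := ltnP s t; first by apply: IH; rewrite -(H3 _ _ _ _ fgh) //; lia.
have sE : s = t by lia.
rewrite sE in fgh uh o; apply: (nex g); first by rewrite -Dt.
by exists h.
Qed.

Variables (R : pzRingType) (f : gen -> R).
Notation W := (half_sum F f a0).

Lemma half_sum_unbounded t i j g : (a0 <= t <= a1)%N -> (j < width F t)%N ->
  (forall g, seg i j g -> ~ exits t g) -> seg i j g -> unbounded F a0 a1 t g ->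
  W t i j = 0.
Proof.
move=> ta jW nex gij u; apply: big_pred0 => D; apply/negbTE/negP => HD.
apply: (half_disk_bounded ta jW HD nex _ u).
by case/HalfDAP: HD => //; [lia | move=> _ _ ->].
Qed.

Hypothesis simple : simple_piece F a0 a1.
Hypothesis R2 : 1 + 1 = 0 :> R.
Hypothesis line_relation : forall i j, (i < j < width F a0)%N ->
  \sum_(i.+1 <= l < j) f (inr (i, l)) * f (inr (l, j)) = 0.
Hypothesis crossing_relation : forall v k, (a0 <= v < a1)%N -> ev F v = Cross k ->
  W v k k.+1 = 0.

Definition quad t i j := \sum_(i.+1 <= l < j) W t i l * W t l j.

Let double0 (x : R) : x + x = 0. Proof. exact: (double_char2 R2). Qed.

(** The gaps which lead to an unbounded gap on the right of the singularity avoid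
    the segments on the left that occur in the recursion, so the induction hypothesis
    applies to all of these. *)
Lemma quad_step t : (a0 <= t < a1)%N ->
  (forall i j, (i < j < width F t)%N -> (forall g, seg i j g -> ~ exits t g) ->
     quad t i j = 0) ->
  forall i j, (i < j < width F t.+1)%N ->
  (forall g, seg i j g -> ~ unbounded F a0 a1 t.+1 g) -> quad t.+1 i j = 0.
Proof.
move=> ta IH i j ij bnd; have tF : (t < size F)%N by lia.
have at_ : (a0 <= t < size F)%N by lia.
have IH' i' j' : (i' < j' < width F t)%N ->
    (forall g h, seg i' j' g -> same_face (ev F t) g h -> seg i j h) -> quad t i' j' = 0.
  move=> ij' H; apply: IH => // g gij [h fgh]; exact/bnd/(H g).
case et: (ev F t) => [k|k|k]; rewrite et in IH'.
- have [kW WE] := lcusp_width front at_ et; rewrite WE in ij.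
  have [iE jE|h|i' j' ij' iE jE] := lcuspP kW ij.
  + by rewrite iE jE /quad big_geq.
  + rewrite /quad big_nat big1 // => l lij.
    have [hl|hl] := boolP ((k <= i <= k.+1)%N != (k <= l <= k.+1)%N).
      by rewrite (half_sum_lcusp_zero front f at_ et _ hl) ?mul0r // WE; lia.
    by rewrite [X in _ * X](half_sum_lcusp_zero front f at_ et) ?mulr0 // ?WE; lia.
  rewrite iE jE /quad big_skip; last by case/andP: ij'.
  rewrite [if _ then _ else _](_ : _ = 0) ?addr0; last first.
    case: ifP => // ik.
    have z l : (k <= l <= k.+1)%N -> W t.+1 (skip k i') l = 0.
      by move=> lk; apply: (half_sum_lcusp_zero front f at_ et); rewrite ?WE /skip; lia.
    by rewrite !z ?mul0r ?addr0 //; lia.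
  rewrite -[RHS](IH' i' j') //; last by move=> g h /=; rewrite iE jE /seg /skip; lia.
  by apply: eq_big_nat => l lij; rewrite !(half_sum_lcusp_skip front f at_ et) //; lia.
- have [kW WE] := cross_width front at_ et; rewrite WE in ij.
  have k0 : W t k k.+1 = 0 by apply: crossing_relation et; lia.
  have K i1 j1 : (i1 < j1 < width F t)%N ->
      (j1 < k)%N || (k.+1 < i1)%N || (i1 < k)%N && (k.+1 < j1)%N ->
      W t.+1 i1 j1 = W t i1 j1.
    by move=> ? ?; apply: (half_sum_cross_keep front f at_ et); rewrite ?WE.
  have A i1 : (i1 < k)%N -> W t.+1 i1 k = W t i1 k.+1 + W t i1 k * f (inl t).
    by move=> ?; apply: (half_sum_cross_above front f at_ et); rewrite ?WE; lia.
  have B j1 : (k.+1 < j1 < width F t)%N ->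
      W t.+1 k.+1 j1 = W t k j1 + f (inl t) * W t k.+1 j1.
    by move=> ?; apply: (half_sum_cross_below front f at_ et); rewrite ?WE; lia.
  have C i1 : (i1 < k)%N -> W t.+1 i1 k.+1 = W t i1 k.
    by move=> ?; apply: (half_sum_cross_lower front f at_ et); rewrite ?WE; lia.
  have E j1 : (k.+1 < j1 < width F t)%N -> W t.+1 k j1 = W t k.+1 j1.
    by move=> ?; apply: (half_sum_cross_upper front f at_ et); rewrite ?WE; lia.
  have Z : W t.+1 k k.+1 = 0.
    by apply: (half_sum_cross_zero front f at_ et); rewrite ?WE; lia.
  have [h|h|h|h h'|h h'|h h'] := crossP k (andP ij).1.
  + have [/andP[ik kj]|h'] := boolP ((i < k)%N && (k.+1 < j)%N); last first.
      rewrite -[RHS](IH' i j) //; last by move=> g h1 /=; rewrite /seg; lia.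
      by apply: eq_big_nat => l lij; rewrite !K //; lia.
    have split2 (G : nat -> R) : \sum_(i.+1 <= l < j) G l =
        \sum_(i.+1 <= l < k) G l + (G k + G k.+1) + \sum_(k.+2 <= l < j) G l.
      rewrite (@big_cat_nat _ _ _ k) //=; last by lia.
      rewrite [\sum_(k <= l < _) _]big_ltn ?[\sum_(k.+1 <= l < _) _]big_ltn; try lia.
      by rewrite !addrA.
    rewrite -[RHS](IH' i j) //; last by move=> g h1 /=; rewrite /seg; lia.
    (* The two terms with the corner occur at both crossing strands and cancel. *)
    rewrite /quad !split2; congr (_ + _ + _).
    * by apply: eq_big_nat => l lij; rewrite !K //; lia.
    * rewrite A // E ?C // ?B //; try lia.
      by rewrite mulrDl mulrDr mulrA addrACA double0 addr0 addrC.
    * by apply: eq_big_nat => l lij; rewrite !K //; lia.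
  + have q1 : quad t i k.+1 = 0.
      by apply: IH' => [|g h1 /=]; rewrite /seg; lia.
    have q2 : quad t i k = 0 by apply: IH' => [|g h1 /=]; rewrite /seg; lia.
    transitivity (\sum_(i.+1 <= l < k)
        (W t i l * W t l k.+1 + W t i l * W t l k * f (inl t))).
      by rewrite /quad h; apply: eq_big_nat => l lij; rewrite K ?A ?mulrDr ?mulrA //; lia.
    rewrite big_split /= -mulr_suml -[X in _ + X * _]/(quad t i k) q2 mul0r addr0.
    by rewrite -[RHS]q1 /quad big_nat_recr /= ?k0 ?mulr0 ?addr0 //; lia.
  + have q1 : quad t k j = 0 by apply: IH' => [|g h1 /=]; rewrite /seg; lia.
    have q2 : quad t k.+1 j = 0 by apply: IH' => [|g h1 /=]; rewrite /seg; lia.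
    transitivity (\sum_(k.+2 <= l < j)
        (W t k l * W t l j + f (inl t) * (W t k.+1 l * W t l j))).
      by rewrite /quad h; apply: eq_big_nat => l lij; rewrite B ?K ?mulrDl ?mulrA //; lia.
    rewrite big_split /= -mulr_sumr -[X in _ + _ * X]/(quad t k.+1 j) q2 mulr0 addr0.
    by rewrite -[RHS]q1 /quad [RHS]big_ltn ?k0 ?mul0r ?add0r //; lia.
  + rewrite /quad h' big_nat_recr /=; last by lia.
    rewrite Z mulr0 addr0 -[RHS](IH' i k); first by apply: eq_big_nat => l lij; rewrite K ?C //; lia.
      by lia.
    by move=> g h1 /=; rewrite /seg; lia.
  + rewrite /quad h big_ltn // Z mul0r add0r -[RHS](IH' k.+1 j).
    * by apply: eq_big_nat => l lij; rewrite E ?K //; lia.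
    * by lia.
    * by move=> g h1 /=; rewrite /seg; lia.
  + by rewrite h h' /quad big_geq.
- have ijs := rcusp_skip front tF et ij.
  have := IH' _ _ ijs.
  rewrite {1}/quad big_skip; last by case/andP: ij.
  rewrite [X in X + _](_ : _ = quad t.+1 i j); last first.
    by apply: eq_big_nat => l lij; rewrite !(half_sum_rcusp front f at_ _ et) //; lia.
  case: ifP => ikj; last first.
    by rewrite addr0; apply=> g h /=; rewrite /seg /skip; lia.
  move=> <-; last by move=> g h /=; rewrite /seg /skip; lia.
  have [kW sE] : (k.+1 < width F t)%N /\ (skip k i = i) /\ (skip k j = j.+2).
    by have := front tF; rewrite et /skip /=; split; lia.
  (* The strands of the cusp contribute two terms on the left only; each contains
     the factor of a half-disk that reaches one of the unbounded regions. *)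
  case: (simple ta et) => u.
    have := unbounded_right ta (ltnW (ltnW kW)) (_ : same_face (ev F t) k k) u.
    by rewrite et /= leqnn eqxx => /(_ isT) /bnd; case; rewrite /seg; lia.
  have t01 : (a0 <= t <= a1)%N by lia.
  have nex g : ~~ (k < g <= k.+2)%N -> seg (skip k i) (skip k j) g -> exits t g -> False.
    move=> gk gij [h]; rewrite et /= => fgh /bnd; apply.
    by move: gk gij fgh; rewrite /seg; lia.
  have nex1 : ~ exits t k.+1 by case=> h; rewrite et /=; lia.
  have nex2 : ~ exits t k.+2.
    case=> h; rewrite et /= => fgh /bnd; apply.
    by move: fgh; rewrite /seg; lia.
  have no g : seg (skip k i) (skip k j) g -> ~ exits t g.
    move=> gij; have [gk|/nex] := boolP (k < g <= k.+2)%N; last by move/(_ gij).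
    by have [->|->] : g = k.+1 \/ g = k.+2 by lia.
  have -> : W t (skip k i) k.+1 = 0.
    apply: (half_sum_unbounded t01 kW _ _ u) => [g gi|]; last by rewrite /seg; lia.
    by apply: no; move: gi; rewrite /seg; lia.
  have -> : W t k (skip k j) = 0.
    apply: (half_sum_unbounded t01 _ _ _ u) => [|g gi|]; first by lia.
      by apply: no; move: gi; rewrite /seg; lia.
    by rewrite /seg; lia.
  by rewrite mulr0 mul0r !addr0.
Qed.

(** At the slice [a1] no gap [exits], so the claim proved by induction has no
    exceptions there. *)
Theorem half_sum_quadratic i j : (i < j < width F a1)%N ->
  \sum_(i.+1 <= l < j) W a1 i l * W a1 l j = 0.
Proof.
suff H t : (a0 <= t <= a1)%N -> forall i j, (i < j < width F t)%N ->
    (forall g, seg i j g -> ~ exits t g) -> quad t i j = 0.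
  move=> ij; apply: (H a1) => // [|g _ [h _ /unbounded_slice]]; first by rewrite a01 leqnn.
  by rewrite ltnn andbF.
elim: t => [|t IH] ta {}i {}j ij nex.
  have a00 : a0 = 0%N by lia.
  rewrite -[RHS](@line_relation i j) ?a00 //.
  by apply: eq_big_nat => l lij; rewrite a00 !half_sum_line //; lia.
have [a0t|a0t] := leqP a0 t; last first.
  have a0E : t.+1 = a0 by lia.
  rewrite a0E in ij *; rewrite -[RHS](@line_relation i j) //.
  by apply: eq_big_nat => l lij; rewrite !half_sum_line //; lia.
(* Half-disks on one side of [l] or on the other would contain the gap [g]. *)
have [[g gij u]|bnd] := pselect (exists2 g, seg i j g & unbounded F a0 a1 t.+1 g).
  rewrite /quad big_nat big1 // => l lij.
  have [gl|gl] := leqP g l.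
    rewrite (half_sum_unbounded ta _ _ _ u) ?mul0r //; first by lia.
    - by move=> h hil; apply: nex; move: hil; rewrite /seg; lia.
    - by move: gij; rewrite /seg; lia.
  rewrite [X in _ * X](half_sum_unbounded ta _ _ _ u) ?mulr0 //; first by lia.
  - by move=> h hil; apply: nex; move: hil; rewrite /seg; lia.
  - by move: gij; rewrite /seg; lia.
apply: quad_step => //; first by lia.
  by apply: IH; lia.
by move=> g gij u; apply: bnd; exists g.
Qed.

End QuadraticRelation.

(** * The DGAs of pieces of a front *)

Section HalfSumMorphisms.
Variable F : seq event.

Lemma half_sum_rmorph (R S : pzRingType) (h : {rmorphism R -> S}) (f : gen -> R) a t i j :
  h (half_sum F f a t i j) = half_sum F (fun x => h (f x)) a t i j.
Proof. by rewrite rmorph_sum; apply: eq_bigr => D _; rewrite rmorph_prod. Qed.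

Lemma boundary_gen a t (D : {set cell F}) x : x \in boundary a t D -> is_gen F a t x.
Proof.
have corner_gen s : s \in [seq s <- iota a (t - a) | is_cross (ev F s) && corner D s] ->
    is_gen F a t (inl s).
  rewrite mem_filter mem_iota /= => /andP[/andP[cr _] st].
  by case: (ev F s) cr => //= _ _; lia.
rewrite !mem_cat => /or3P[] /mapP[y].
- by rewrite mem_filter mem_rev => /andP[_ /corner_gen gy] ->.
- rewrite mem_filter => /andP[/andP[yy _] /allpairsP[[k l] /= [_ lW yE]]] ->.
  by move: lW yy; rewrite yE mem_iota /=; lia.
- by rewrite mem_filter => /andP[_ /corner_gen gy] ->.
Qed.

Lemma half_sum_eq (R : pzRingType) (f f' : gen -> R) a t i j :
  (forall x, is_gen F a t x -> f x = f' x) -> half_sum F f a t i j = half_sum F f' a t i j.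
Proof.
move=> ff'; apply: eq_bigr => D _.
by apply: eq_big_seq => x /boundary_gen /ff'.
Qed.

Lemma is_gen_widen a b b' x : (b <= b')%N -> is_gen F a b x -> is_gen F a b' x.
Proof. by move=> bb'; case: x => [t|[i j]] //=; lia. Qed.

Lemma named_gen a b (y : gens F a b) : named F a b (val y) = fgen y.
Proof. by rewrite /named valK. Qed.

Lemma named_Sub a b x (gx : is_gen F a b x) :
  named F a b x = fgen (Sub x gx : gens F a b).
Proof. by rewrite -named_gen SubK. Qed.

End HalfSumMorphisms.

Section Pieces.
Variables (Gamma : zmodType) (gamma : Gamma) (F : seq event) (mu : nat -> nat -> Gamma).
Hypothesis front : forall t, (t < size F)%N -> (pos (ev F t) + nin (ev F t) <= width F t)%N.
Hypothesis maslov : is_maslov gamma F mu.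
Notation deg a := (degree gamma F mu a).
Notation DA := (DA gamma F mu).

Lemma dgen_vertex a b v : (a <= v < b)%N -> (b <= size F)%N -> ~~ is_lcusp (ev F v) ->
  dgen F a b (inl v) = (if is_rcusp (ev F v) then 1 else 0) +
    half_sum F (named F a b) a v (pos (ev F v)) (pos (ev F v)).+1.
Proof. by move=> ab bF nl; rewrite -(vertex_sum front ab bF nl) addrA. Qed.

Lemma incl_named a b b' x : (b <= b')%N -> is_gen F a b x ->
  incl gamma F mu a b a b' (named F a b x) = named F a b' x.
Proof. by move=> bb' gx; rewrite (named_Sub gx) /incl fext_gen SubK. Qed.

Lemma incl_half_sum a b b' t i j : (t <= b <= b')%N ->
  incl gamma F mu a b a b' (half_sum F (named F a b) a t i j) =
  half_sum F (named F a b') a t i j.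
Proof.
move=> bb'; rewrite /incl fextE half_sum_rmorph; apply: half_sum_eq => x gx.
by rewrite -fextE; apply: incl_named; [lia | apply: is_gen_widen gx; lia].
Qed.

Lemma incl_dgen a b b' x : (b <= b' <= size F)%N -> is_gen F a b x ->
  incl gamma F mu a b a b' (dgen F a b x) = dgen F a b' x.
Proof.
case/andP=> bb' b'F; case: x => [v|[i j]] /= gx.
  case/andP: gx => ab nl.
  rewrite -/(dgen F a b (inl v)) -/(dgen F a b' (inl v)) !dgen_vertex //; try lia.
  rewrite /incl fextE rmorphD; congr (_ + _).
    by case: ifP => _; rewrite ?rmorph1 ?rmorph0.
  by rewrite -fextE; apply: incl_half_sum; lia.
rewrite /incl fextE rmorph_sum; apply: eq_big_nat => k ijk.
by rewrite rmorphM -!fextE -/(incl gamma F mu a b a b') !incl_named //=; lia.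
Qed.

(** The values of [w_glue] on generators, written in the larger algebra from the
    start. *)
Definition glue_letter a0 a1 b x : DA_alg F a0 b :=
  match x with
  | inl t => named F a0 b (inl t)
  | inr (i, j) => half_sum F (named F a0 b) a0 a1 i j
  end.

Lemma w_glueE a0 a1 b : (a1 <= b)%N ->
  w_glue gamma F mu a0 a1 b =1 fext (fun x : gens F a1 b => glue_letter a0 a1 b (val x)).
Proof.
move=> a1b p; apply: eq_bigr => m _; congr (_ *: _); apply: eq_bigr => x _.
case: (val x) => [t|[i j]] //=.
by rewrite /wsum -/(half_sum F (named F a0 a1) a0 a1 i j) incl_half_sum ?leqnn.
Qed.

Notation glue a0 a1 b := (fext (fun x : gens F a1 b => glue_letter a0 a1 b (val x))).

Lemma glue_named a0 a1 b x : is_gen F a1 b x ->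
  glue a0 a1 b (named F a1 b x) = glue_letter a0 a1 b x.
Proof. by move=> gx; rewrite (named_Sub gx) fext_gen SubK. Qed.

Lemma glue_half_sum a0 a1 b t i j : (a0 <= a1 <= t)%N -> (t <= b <= size F)%N ->
  (i < j < width F t)%N ->
  glue a0 a1 b (half_sum F (named F a1 b) a1 t i j) = half_sum F (named F a0 b) a0 t i j.
Proof.
move=> a01 tb ij; rewrite fextE half_sum_rmorph.
rewrite -(half_sum_glue front (f' := glue_letter a0 a1 b) a01) //; last by lia.
apply: half_sum_eq => x gx; rewrite -fextE; apply: glue_named.
by apply: is_gen_widen gx; lia.
Qed.

Lemma glue_dgen a0 a1 b v : (a0 <= a1)%N -> (b <= size F)%N -> is_gen F a1 b (inl v) ->
  glue a0 a1 b (dgen F a1 b (inl v)) = dgen F a0 b (inl v).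
Proof.
move=> a01 bF /= /andP[ab nl].
rewrite -/(dgen F a1 b (inl v)) -/(dgen F a0 b (inl v)) !dgen_vertex //; try lia.
rewrite fextE rmorphD; congr (_ + _).
  by case: ifP => _; rewrite ?rmorph1 ?rmorph0.
rewrite -fextE glue_half_sum //; try lia.
by rewrite ltnSn (vertex_width front ab bF nl).
Qed.

Lemma named_deg a b x : is_gen F a b x ->
  fcomp (fun x : gens F a b => deg a (val x)) (deg a x) (named F a b x).
Proof.
move=> gx; rewrite (named_Sub gx).
have := @fcomp_gen _ _ (fun x : gens F a b => deg a (val x)) (Sub x gx).
by rewrite SubK.
Qed.

Lemma maslov_skip_right t k i : (t < size F)%N -> ev F t = RCusp k ->
  (i < width F t.+1)%N -> mu t.+1 i = mu t (skip k i).
Proof.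
move=> tF et iW; have [H _] := maslov tF; apply: H.
  by move: iW; have := front tF; rewrite widthS // et /skip /=; lia.
rewrite et /next /skip; have [ik|ik] := ltnP i k; first by rewrite addn0 ik.
rewrite addn2 !ifF; [|lia|lia].
by congr Some; lia.
Qed.

Lemma maslov_skip_left t k i : (t < size F)%N -> ev F t = LCusp k ->
  (i < width F t)%N -> mu t.+1 (skip k i) = mu t i.
Proof.
move=> tF et iW; have [H _] := maslov tF; apply: H => //.
rewrite et /next /skip; have [ik|ik] := ltnP i k; first by rewrite addn0.
by rewrite addn2.
Qed.

Lemma maslov_cross t k i : (t < size F)%N -> ev F t = Cross k ->
  (i < width F t)%N ->
  mu t.+1 (if i == k then k.+1 else if i == k.+1 then k else i) = mu t i.
Proof.
by move=> tF et iW; have [H _] := maslov tF; apply: H => //; rewrite et.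
Qed.

(** At each singularity the recursion and the Maslov potential permute the strands in
    the same way, and a corner contributes the difference of the potentials of the
    two strands. *)
Lemma half_sum_deg a b t i j : (a <= t <= b)%N -> (b <= size F)%N ->
  (i < j < width F t)%N ->
  fcomp (fun x : gens F a b => deg a (val x)) (mu t i - mu t j - gamma)
    (half_sum F (named F a b) a t i j).
Proof.
case/andP=> at_ tb bF; elim: t at_ tb i j => [|t IH] at_ tb i j ij.
  have a00 : a = 0%N by lia.
  rewrite -a00 in ij *; rewrite half_sum_line //; last by lia.
  by apply: (named_deg (x := inr (i, j))).
have [at'|at'] := leqP a t; last first.
  have aE : t.+1 = a by lia.
  rewrite aE in ij *; rewrite half_sum_line //; last by lia.
  by apply: (named_deg (x := inr (i, j))).
have tF : (t < size F)%N by lia.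
have att : (a <= t < size F)%N by lia.
have {}IH := IH at' (ltnW tb).
case et: (ev F t) => [k|k|k].
- have [kW W] := lcusp_width front att et; rewrite W in ij.
  have [-> ->|h|i' j' ij' -> ->] := lcuspP kW ij.
  + rewrite (half_sum_lcusp_one front _ att et).
    have [_] := maslov tF; rewrite et => ->.
    by rewrite [_ + gamma]addrC addrK subrr; apply: fcomp1.
  + by rewrite (half_sum_lcusp_zero front _ att et) ?W //; apply: fcomp0.
  + rewrite (half_sum_lcusp_skip front _ att et) // !(maslov_skip_left tF et) //; try lia.
    exact: IH.
- have [kW W] := cross_width front att et; rewrite W in ij.
  have M l : (l < width F t)%N -> l != k -> l != k.+1 -> mu t.+1 l = mu t l.
    by move=> lW lk lk1; rewrite -(maslov_cross tF et lW) (negbTE lk) (negbTE lk1).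
  have Mk : mu t.+1 k.+1 = mu t k.
    by rewrite -(maslov_cross tF et (ltnW kW)) eqxx.
  have Mk1 : mu t.+1 k = mu t k.+1.
    by rewrite -(maslov_cross tF et kW) eqxx gtn_eqF.
  have v_deg : fcomp (fun x : gens F a b => deg a (val x)) (mu t k - mu t k.+1)
      (named F a b (inl t)).
    have := @named_deg a b (inl t); rewrite /= et; apply.
    by rewrite at' tb.
  have [h|h|h|h h'|h h'|h h'] := crossP k (andP ij).1.
  + rewrite (half_sum_cross_keep front _ att et) ?W // !M; try lia.
    exact: IH.
  + rewrite (half_sum_cross_above front _ att et) ?W // h Mk1 M; try lia.
    apply: fcompD; first by apply: IH; lia.
    rewrite (_ : mu t i - _ - _ = (mu t i - mu t k - gamma) + (mu t k - mu t k.+1)).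
      by apply: fcompM => //; apply: IH; lia.
    by rewrite [RHS]addrAC subrKA.
  + rewrite (half_sum_cross_below front _ att et) ?W // h Mk M; try lia.
    apply: fcompD; first by apply: IH; lia.
    rewrite (_ : mu t k - _ - _ = (mu t k - mu t k.+1) + (mu t k.+1 - mu t j - gamma)).
      by apply: fcompM => //; apply: IH; lia.
    by rewrite !addrA subrK.
  + rewrite (half_sum_cross_lower front _ att et) ?W // h' Mk M; try lia.
    by apply: IH; lia.
  + rewrite (half_sum_cross_upper front _ att et) ?W // h Mk1 M; try lia.
    by apply: IH; lia.
  + by rewrite (half_sum_cross_zero front _ att et) ?W //; apply: fcomp0.
- have ijs := rcusp_skip front tF et ij.
  rewrite (half_sum_rcusp front _ att _ et) // !(maslov_skip_right tF et); try lia.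
  exact: IH.
Qed.

Lemma dgen_deg a b x : (b <= size F)%N -> is_gen F a b x ->
  fcomp (fun x : gens F a b => deg a (val x)) (deg a x - gamma) (dgen F a b x).
Proof.
move=> bF; case: x => [v|[i j]] gx.
  have /andP[ab nl] := gx; rewrite dgen_vertex //.
  have H : fcomp (fun x : gens F a b => deg a (val x))
     (mu v (pos (ev F v)) - mu v (pos (ev F v)).+1 - gamma)
     (half_sum F (named F a b) a v (pos (ev F v)) (pos (ev F v)).+1).
    apply: half_sum_deg => //; first by lia.
    by rewrite ltnSn (vertex_width front ab bF nl).
  have vF : (v < size F)%N by lia.
  have [_] := maslov vF; move: H nl; rewrite /=; case: (ev F v) => k //= H _.
    by rewrite add0r.
  move=> muE; rewrite subrr; apply: fcompD; first exact: fcomp1.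
  by move: H; rewrite muE [_ + gamma]addrC addrK subrr.
rewrite /dgen big_nat; apply: fcomp_sum => k ijk.
rewrite (_ : deg a (inr (i, j)) - gamma = deg a (inr (i, k)) + deg a (inr (k, j))).
  by apply: fcompM; apply: named_deg; move: gx ijk => /=; lia.
rewrite /= [RHS]addrA; congr (_ - _).
by rewrite [RHS]addrAC addrA subrK.
Qed.

Lemma char_proj_dgen a b x : is_gen F a b x -> char_proj (dgen F a b x : DA a b) = 0.
Proof.
move=> gx; apply/quo_pi_eq0/ideal_gen; exists (fgen (Sub x gx : gens F a b)).
by rewrite /= fder_gen SubK.
Qed.

(** The quadratic relation in the characteristic algebra, where the differentials
    of line generators and of crossings are zero. *)
Lemma glue_line_relation a0 a1 b i j :
  (a0 <= a1 <= b)%N -> (b <= size F)%N -> simple_piece F a0 a1 ->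
  (i < j < width F a1)%N ->
  char_proj (glue a0 a1 b (dgen F a1 b (inr (i, j))) : DA a0 b) = 0.
Proof.
case/andP=> a01 a1b bF simple ij.
pose f x : char_alg (DA a0 b) := char_proj (named F a0 b x : DA a0 b).
have R2 : 1 + 1 = 0 :> char_alg (DA a0 b).
  rewrite -[X in X + X](rmorph1 (@char_proj Gamma (DA a0 b))) -rmorphD.
  by rewrite free_char2 rmorph0.
have fE t i' j' : char_proj (half_sum F (named F a0 b) a0 t i' j' : DA a0 b) =
    half_sum F f a0 t i' j'.
  exact: (@half_sum_rmorph F _ _ (@char_proj Gamma (DA a0 b))).
have line i' j' : (i' < j' < width F a0)%N ->
    \sum_(i'.+1 <= l < j') f (inr (i', l)) * f (inr (l, j')) = 0.
  move=> ij'; rewrite -[RHS](@char_proj_dgen a0 b (inr (i', j'))) //.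
  rewrite [in RHS]/dgen [RHS](rmorph_sum (@char_proj Gamma (DA a0 b))).
  by apply: eq_bigr => l _; rewrite -[LHS](rmorphM (@char_proj Gamma (DA a0 b))).
have cross v k : (a0 <= v < a1)%N -> ev F v = Cross k -> half_sum F f a0 v k k.+1 = 0.
  move=> av ev_v; have vb : (a0 <= v < b)%N by lia.
  have nl : ~~ is_lcusp (ev F v) by rewrite ev_v.
  rewrite -fE -[RHS](@char_proj_dgen a0 b (inl v)); last by rewrite /= vb.
  by rewrite dgen_vertex // ev_v /= add0r.
rewrite -[RHS](half_sum_quadratic front a01 (leq_trans a1b bF) simple R2 line cross ij).
have -> : glue a0 a1 b (dgen F a1 b (inr (i, j))) = \sum_(i.+1 <= l < j)
    half_sum F (named F a0 b) a0 a1 i l * half_sum F (named F a0 b) a0 a1 l j.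
  rewrite /dgen fextE rmorph_sum; apply: eq_big_nat => l ijl.
  by rewrite rmorphM -!fextE !glue_named //=; lia.
rewrite [LHS](rmorph_sum (@char_proj Gamma (DA a0 b))); apply: eq_bigr => l _.
by rewrite -!fE -[RHS](rmorphM (@char_proj Gamma (DA a0 b))).
Qed.

Lemma glue_letter_deg a0 a1 b x : (a0 <= a1 <= b)%N -> (b <= size F)%N ->
  is_gen F a1 b x ->
  fcomp (fun y : gens F a0 b => deg a0 (val y)) (deg a1 x) (glue_letter a0 a1 b x).
Proof.
move=> a01 bF; case: x => [t|[i j]] gx.
  by apply: (named_deg (x := inl t)); move: gx => /=; lia.
exact: half_sum_deg.
Qed.

Lemma glue_char a0 a1 b x : (a0 <= a1 <= b)%N -> (b <= size F)%N ->
  simple_piece F a0 a1 -> is_gen F a1 b x ->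
  char_proj (glue a0 a1 b (dgen F a1 b x) : DA a0 b) = 0.
Proof.
move=> a01 bF simple; case: x => [v|[i j]] gx; last exact: glue_line_relation.
have [a0a1 _] := andP a01.
rewrite glue_dgen //; apply: char_proj_dgen.
by move: gx => /=; lia.
Qed.

Lemma gens_split a0 a1 a2 a3 (x : gens F a0 a3) : (a1 <= a2)%N ->
  {y : gens F a0 a2 | val y = val x} +
  {z : gens F a1 a3 | val z = val x & ~~ is_gen F a0 a2 (val x)}.
Proof.
move=> a12; case: (boolP (is_gen F a0 a2 (val x))) => gx.
  by left; exists (Sub (val x) gx); rewrite SubK.
have gx' : is_gen F a1 a3 (val x).
  by move: (valP x) gx; case: (val x) => [t|[i j]] /=; lia.
by right; exists (Sub (val x) gx'); rewrite ?SubK.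
Qed.

Theorem pieces_pushout a0 a1 a2 a3 : (a0 <= a1 <= a2)%N -> (a2 <= a3 <= size F)%N ->
  simple_piece F a0 a1 ->
  char_pushout (incl gamma F mu a1 a2 a1 a3 : DA a1 a2 -> DA a1 a3)
    (glue a0 a1 a2 : DA a1 a2 -> DA a0 a2) (glue a0 a1 a3 : DA a1 a3 -> DA a0 a3)
    (incl gamma F mu a0 a2 a0 a3 : DA a0 a2 -> DA a0 a3).
Proof.
case/andP=> a01 a12 /andP[a23 a3F] simple.
have a2F : (a2 <= size F)%N := leq_trans a23 a3F.
have D1 a b : (b <= size F)%N -> forall x : gens F a b,
    fcomp (fun x : gens F a b => deg a (val x)) (deg a (val x) - gamma) (dgen F a b (val x)).
  by move=> bF x; apply: dgen_deg => //; apply: valP.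
pose side (x : gens F a0 a3) : gens F a0 a2 + gens F a1 a3 :=
  match gens_split x a12 with inl y => inl (sval y) | inr z => inr (s2val z) end.
apply: (@free_pushout Gamma gamma (gens F a1 a2) (gens F a1 a3) (gens F a0 a2)
  (gens F a0 a3) _ _ _ _ _ _ _ _ _ _ _ _ (D1 _ _ a2F) (D1 _ _ a3F) (D1 _ _ a2F)
  (D1 _ _ a3F) _ _ _ _ _ _ _ _ _ side).
- by move=> x; apply: named_deg; apply: is_gen_widen (valP x).
- by move=> x; apply: glue_letter_deg; rewrite ?a01 //; apply: valP.
- by move=> x; apply: glue_letter_deg; rewrite ?a01 ?(leq_trans a12) //; apply: valP.
- by move=> x; apply: named_deg; apply: is_gen_widen (valP x).
- move=> x; rewrite -/(incl gamma F mu a1 a2 a1 a3 _) incl_dgen ?a23 ?(valP x) //.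
  by apply: char_proj_dgen; apply: is_gen_widen (valP x).
- by move=> x; apply: glue_char; rewrite ?a01 //; apply: valP.
- by move=> x; apply: glue_char; rewrite ?a01 ?(leq_trans a12) //; apply: valP.
- move=> x; rewrite -/(incl gamma F mu a0 a2 a0 a3 _) incl_dgen ?a23 ?(valP x) //.
  by apply: char_proj_dgen; apply: is_gen_widen (valP x).
- move=> x; rewrite glue_named; last exact: is_gen_widen (valP x).
  rewrite -/(incl gamma F mu a0 a2 a0 a3 _).
  case: (val x) (valP x) => [t|[i j]] gx.
    by rewrite incl_named //; move: gx => /=; lia.
  by rewrite incl_half_sum // a12.
- move=> x; rewrite /side; case: (gens_split x a12) => [[y /= yx]|[z /= zx nx]].
    rewrite yx named_gen; split=> //.
    by rewrite -/(incl gamma F mu a0 a2 a0 a3 _) -yx incl_dgen ?a23 ?(valP y).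
  have [t xE] : exists t, val x = inl t.
    have {}nx : ~~ is_gen F a0 a2 (val x) := nx.
    by move: (valP x) nx; case: (val x) => [t|[i j]] gx nx; [exists t | case/negP: nx].
  have {}zx : val z = val x := zx.
  have gz := valP z; rewrite zx xE in gz.
  rewrite -[sval z]/(val z) -[sval x]/(val x) zx -(named_gen x) xE.
  by split=> //; apply: esym; apply: glue_dgen.
- move=> y; have gy : is_gen F a0 a3 (val y) := is_gen_widen a23 (valP y).
  exists (Sub (val y) gy); rewrite /side; case: gens_split => [[y' y'E]|[z zE nz]].
    by congr inl; apply: val_inj; rewrite -[LHS]/(val y') y'E SubK.
  by exfalso; move: nz; rewrite SubK (valP y).
- move=> z; case: (boolP (is_gen F a1 a2 (val z))) => gz.
    by right; exists (Sub (val z) gz); rewrite SubK named_gen.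
  have gz' : is_gen F a0 a3 (val z).
    by move: (valP z) gz; case: (val z) => [t|[i j]] /=; lia.
  left; exists (Sub (val z) gz'); rewrite /side.
  case: gens_split => [[y yE]|[z' z'E nz']].
    exfalso; have := valP y; rewrite yE SubK.
    by move: gz (valP z); case: (val z) => [t|[i j]] /=; lia.
  by congr inr; apply: val_inj; rewrite -[LHS]/(val z') z'E SubK.
Qed.

End Pieces.

Section FinalStatement.
Variables (Gamma : zmodType) (gamma : Gamma) (F : seq event) (mu : nat -> nat -> Gamma).

Lemma char_pushout_eq (A B C P : predga Gamma) (f f2 : A -> B) (g g2 : A -> C)
    (g' g'2 : B -> P) (f' f'2 : C -> P) :
  f =1 f2 -> g =1 g2 -> g' =1 g'2 -> f' =1 f'2 ->
  char_pushout f g g' f' -> char_pushout f2 g2 g'2 f'2.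
Proof.
move=> ff gg gg' ff' [cf [cg [cg' [cf' [[if_ ig ig' if'] po]]]]].
exists cf, cg, cg', cf'; split=> //; split=> x.
- by rewrite if_ ff.
- by rewrite ig gg.
- by rewrite ig' gg'.
- by rewrite if' ff'.
Qed.

Lemma w_lineE a0 a : w_line gamma F mu a0 a =1
  fext (fun x : gens F a a => glue_letter F a0 a a (val x)).
Proof.
move=> p; apply: eq_bigr => m _; congr (_ *: _); apply: eq_bigr => x _.
by case: (val x) (valP x) => [t|[i j]] //=; lia.
Qed.
End FinalStatement.

Theorem theorem6p4 (Gamma : zmodType) (gamma : Gamma)
    (Gamma_cyclic : cyclic_generator gamma)
    (K : seq event) (mu : nat -> nat -> Gamma)
    (K_front : is_front K) (K_simple : simple_front K)
    (mu_maslov : is_maslov gamma K mu) :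
  (forall a : nat, (a <= size K)%N ->
     simple_piece K 0 a -> simple_piece K a (size K) ->
     char_pushout
       (incl gamma K mu a a a (size K) : I_ gamma K mu a -> D_ gamma K mu a)
       (w_line gamma K mu 0 a : I_ gamma K mu a -> A_ gamma K mu a)
       (w_glue gamma K mu 0 a (size K) : D_ gamma K mu a -> Ch gamma K mu)
       (incl gamma K mu 0 a 0 (size K) : A_ gamma K mu a -> Ch gamma K mu))
  /\
  (forall a0 a1 a2 a3 : nat, (a0 <= a1 <= a2)%N -> (a2 <= a3 <= size K)%N ->
     simple_piece K a0 a1 -> simple_piece K a1 a2 -> simple_piece K a1 a3 ->
     char_pushout
       (incl gamma K mu a1 a2 a1 a3 : DA gamma K mu a1 a2 -> DA gamma K mu a1 a3)
       (w_glue gamma K mu a0 a1 a2 : DA gamma K mu a1 a2 -> DA gamma K mu a0 a2)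
       (w_glue gamma K mu a0 a1 a3 : DA gamma K mu a1 a3 -> DA gamma K mu a0 a3)
       (incl gamma K mu a0 a2 a0 a3 : DA gamma K mu a0 a2 -> DA gamma K mu a0 a3)).
Proof.
have [front _] := K_front; split=> [a aK simple _|a0 a1 a2 a3 a012 a23 simple _ _].
  have ha : (0 <= a <= a)%N by rewrite leqnn.
  have hK : (a <= size K <= size K)%N by rewrite aK leqnn.
  have H := pieces_pushout front mu_maslov ha hK simple.
  refine (@char_pushout_eq Gamma _ _ _ _ _ _ _ _ _ _ _ _ (frefl _) _ _ (frefl _) H) => p.
    by rewrite w_lineE.
  by rewrite w_glueE.
have [a01 a12] := andP a012; have [a23' _] := andP a23.
have H := pieces_pushout front mu_maslov a012 a23 simple.
refine (@char_pushout_eq Gamma _ _ _ _ _ _ _ _ _ _ _ _ (frefl _) _ _ (frefl _) H) => p.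
  by rewrite w_glueE.
by rewrite w_glueE // (leq_trans a12).
Qed.
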